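(* Let $(\Omega,\mathcal{H},\mathbb{E})$ be a sub-linear expectation space satisfying condition (CC) with the family $\mathcal{P}$. Let $\{X_n;n\geq 1\}$ be a sequence of independent random variables in it, and let $\{a_n\}$ be real numbers with $1\leq a_n\nearrow\infty$ and $\sum_{n=1}^{\infty}\mathbb{E}[X_n^2]/a_n^2<\infty$. Denote $S_n=\sum_{i=1}^nX_i$. Then: (i) there exists $P\in\mathcal{P}$ such that $$P\left(\limsup_{n\rightarrow\infty}\frac{S_n-\mathbb{E}[S_n]}{a_n}=0\ \text{ and }\ \liminf_{n\rightarrow\infty}\frac{S_n-\hat{\mathcal{E}}[S_n]}{a_n}=0\right)=1;$$ (ii) for any sequence of real numbers $\{\mu_n\}$ with $\hat{\mathcal{E}}[X_n]\leq\mu_n\leq\mathbb{E}[X_n]$ for all $n$, there exists $P\in\mathcal{P}$ such that $$P\left(\lim_{n\rightarrow\infty}\frac{\sum_{i=1}^n(X_i-\mu_i)}{a_n}=0\right)=1.$$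
   Context: A sub-linear expectation space $(\Omega,\mathcal{H},\mathbb{E})$: $(\Omega,\mathcal{F})$ is a measurable space, $\mathcal{H}$ is a linear space of real functions on $\Omega$ closed under composition with locally Lipschitz functions of polynomial growth $|\varphi(x)-\varphi(y)|\le C(1+|x|^m+|y|^m)|x-y|$; $\mathbb{E}:\mathcal{H}\to[-\infty,\infty]$ is monotone, constant preserving, sub-additive and positively homogeneous; $\hat{\mathcal{E}}[X]=-\mathbb{E}[-X]$. Independence: $Y$ is independent of $X$ if $\mathbb{E}[\varphi(X,Y)]=\mathbb{E}\big[\mathbb{E}[\varphi(x,Y)]|_{x=X}\big]$ for every bounded Lipschitz $\varphi$; a sequence is independent if $X_{i+1}$ is independent of $(X_1,\dots,X_i)$ for each $i$. Condition (CC): $\mathbb{E}[X]=\sup_{P\in\mathcal{P}}P[X]$ for all bounded $X\in\mathcal{H}$, where $\mathcal{P}$ is a family of probability measures on $(\Omega,\sigma(\mathcal{H}))$ that is countably-dimensionally weakly compact: for any bounded $Y_1,Y_2,\dots\in\mathcal{H}$ and any sequence $\{P_n\}\subset\mathcal{P}$ there are a subsequence $\{n_k\}$ and $P\in\mathcal{P}$ with $\lim_k P_{n_k}[\varphi(Y_1,\dots,Y_d)]=P[\varphi(Y_1,\dots,Y_d)]$ for all bounded Lipschitz $\varphi$ on $\mathbb{R}^d$, $d\ge1$. *)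

(* Defs.v *)
From HB Require Import structures.
From mathcomp Require Import all_boot all_order all_algebra.
From mathcomp Require Import all_classical all_reals all_analysis.
Set Implicit Arguments. Unset Strict Implicit. Unset Printing Implicit Defensive.
Import Order.TTheory GRing.Theory Num.Theory.
Import numFieldNormedType.Exports.
Local Open Scope classical_set_scope.
Local Open Scope ring_scope.

Section Defs.
Context {R : realType}.

Definition nrm1 (d : nat) (x : 'I_d -> R) : R := \sum_(i < d) `|x i|.

Definition loclip_poly (d : nat) (phi : ('I_d -> R) -> R) : Prop :=
  exists (C : R) (m : nat), forall x y,
    `|phi x - phi y| <= C * (1 + nrm1 x ^+ m + nrm1 y ^+ m) * nrm1 (fun i => x i - y i).

Definition bdd_lip (d : nat) (phi : ('I_d -> R) -> R) : Prop :=
  (exists C : R, forall x y, `|phi x - phi y| <= C * nrm1 (fun i => x i - y i)) /\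
  (exists M : R, forall x, `|phi x| <= M).

Definition bdd_lip2 (d : nat) (phi : ('I_d -> R) -> R -> R) : Prop :=
  (exists C : R, forall x x' y y',
      `|phi x y - phi x' y'| <= C * (nrm1 (fun i => x i - x' i) + `|y - y'|)) /\
  (exists M : R, forall x y, `|phi x y| <= M).

Definition bounded_fun {T : Type} (X : T -> R) : Prop :=
  exists M : R, forall w, `|X w| <= M.

Variable (Omega : Type).

Record sublinear_space (H : set (Omega -> R)) (E : (Omega -> R) -> \bar R) : Prop := {
  H_zero : H (fun _ => 0);
  H_add : forall X Y, H X -> H Y -> H (fun w => X w + Y w);
  H_scale : forall (c : R) X, H X -> H (fun w => c * X w);
  H_comp : forall (d : nat) (Y : 'I_d -> Omega -> R) (phi : ('I_d -> R) -> R),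
      (forall i, H (Y i)) -> loclip_poly phi -> H (fun w => phi (fun i => Y i w));
  E_mono : forall X Y, H X -> H Y -> (forall w, X w <= Y w) -> (E X <= E Y)%E;
  E_cst : forall c : R, E (fun _ => c) = c%:E;
  E_subadd : forall X Y, H X -> H Y ->
      ~ (E X = +oo%E /\ E Y = -oo%E) -> ~ (E X = -oo%E /\ E Y = +oo%E) ->
      (E (fun w => (X w + Y w)%R) <= E X + E Y)%E;
  E_homog : forall (l : R) X, 0 < l -> H X -> E (fun w => (l * X w)%R) = (l%:E * E X)%E
}.

Definition Ehat (E : (Omega -> R) -> \bar R) (X : Omega -> R) : \bar R :=
  (- E (fun w => (- X w)%R))%E.

(* Y is independent of (X_0, ..., X_{d-1}) *)
Definition indep_of (E : (Omega -> R) -> \bar R) (d : nat)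
    (X : 'I_d -> Omega -> R) (Y : Omega -> R) : Prop :=
  forall phi : ('I_d -> R) -> R -> R, bdd_lip2 phi ->
    E (fun w => phi (fun i => X i w) (Y w)) =
    E (fun w => fine (E (fun w' => phi (fun i => X i w) (Y w')))).

Definition indep_seq (E : (Omega -> R) -> \bar R) (X : nat -> Omega -> R) : Prop :=
  forall n : nat, (0 < n)%N -> indep_of E (fun i : 'I_n => X i) (X n).

End Defs.

Definition sigH {R : realType} {Omega : Type} (H : set (Omega -> R)) : set (set Omega) :=
  [set A | exists X, H X /\ exists B : set R, measurable B /\ A = X @^-1` B].

Definition OmegaH {R : realType} {Omega : pointedType} (H : set (Omega -> R)) :=
  g_sigma_algebraType (sigH H).

Definition condCC {R : realType} {Omega : pointedType} (H : set (Omega -> R))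
    (E : (Omega -> R) -> \bar R) (Pfam : set (probability (OmegaH H) R)) : Prop :=
  (forall X : Omega -> R, H X -> bounded_fun X ->
     E X = ereal_sup [set (\int[P]_w (X w)%:E)%E | P in Pfam]) /\
  (forall (Y : nat -> Omega -> R) (Pn : nat -> probability (OmegaH H) R),
     (forall k, H (Y k) /\ bounded_fun (Y k)) -> (forall n, Pfam (Pn n)) ->
     exists (nk : nat -> nat) (P : probability (OmegaH H) R),
       (forall k, (nk k < nk k.+1)%N) /\ Pfam P /\
       forall (d : nat) (phi : ('I_d -> R) -> R), (0 < d)%N -> bdd_lip phi ->
         (fun k => (\int[Pn (nk k)]_w (phi (fun i : 'I_d => Y i w))%:E)%E) @ \oo
           --> (\int[P]_w (phi (fun i : 'I_d => Y i w))%:E)%E).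
Arguments condCC {R Omega} H E Pfam.

(* Main.v *)
(** Idea. (ii) Truncate X_k at a level c_k and write Y_k for the result. By independence,
    an increment h_k (Y_k - nu_k), with h_k a bounded Lipschitz function of the past and
    -E[-Y_k] <= nu_k <= E[Y_k], can only increase E, so martingale transforms have
    nonnegative E. Doob's maximal inequality holds pathwise up to such a transform, hence
    the squared oscillations of T_n = sum_(k<n) (Y_k - nu_k) / a_k after suitable times m_j,
    summed over j < K, form a functional G_K with E[-G_K] >= -C. Some P_K in the family then
    has P_K[G_K] <= C + 1, and as G_K is nondecreasing in K, a weak limit P satisfies
    P[G_K] <= C + 1 for every K. So sup_K G_K is finite P-almost surely, which makes T_n
    Cauchy, and Kronecker's lemma concludes.
    (i) Apply (ii) with mu_k equal to E[X_k] and to -E[-X_k] alternately, on blocks growing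
    so fast that at the end of each block the previous ones are negligible with respect
    to a_n, and use E[S_n] = sum_(i<=n) E[X_i]. *)
Require Import Defs.
From HB Require Import structures.
From mathcomp Require Import all_boot all_order all_algebra.
From mathcomp Require Import all_classical all_reals all_analysis.
From mathcomp Require Import measurable_realfun.
From mathcomp Require Import ring lra.
Set Implicit Arguments.
Unset Strict Implicit.
Unset Printing Implicit Defensive.
Import Order.TTheory GRing.Theory Num.Theory.
Import numFieldNormedType.Exports.
Local Open Scope classical_set_scope.
Local Open Scope ring_scope.

(** * Deterministic inequalities and Kronecker's lemma *)

Section RealSequences.
Context {R : realType}.
Implicit Types (a d v x y : nat -> R) (m n k : nat) (c s t : R).

(** Zeroing the first [m] terms instead of shifting the sequence keeps [k] as the time index, so
    dependence on the past stays readable. *)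
Definition from m d k : R := if (m <= k)%N then d k else 0.

Lemma sum_from m d n :
  \sum_(i < n) from m d i = \sum_(i < maxn n m) d i - \sum_(i < m) d i.
Proof.
elim: n => [|n IH]; first by rewrite big_ord0 max0n subrr.
rewrite big_ord_recr /= IH /from; case: leqP => mn.
  rewrite !(maxn_idPl _) ?(leq_trans mn)// big_ord_recr /=; lra.
by rewrite !(maxn_idPr _) ?(ltnW mn)// addr0.
Qed.

Lemma small_tail v L (e : R) : (forall k, 0 <= v k) ->
  (forall n, \sum_(i < n) v i <= L) -> 0 < e ->
  exists m, forall n, \sum_(i < n) from m v i <= e.
Proof.
move=> v0 vL e0.
pose S := [set \sum_(i < n) v i | n in [set: nat]].
have hS : has_sup S.
  split; first by exists (\sum_(i < 0) v i), 0.
  by exists L => _ [n _ <-].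
have [_ [m _ <-] hm] := sup_adherent e0 hS.
exists m => n; rewrite sum_from.
have : \sum_(i < maxn n m) v i <= sup S by apply: sup_upper_bound => //; exists (maxn n m).
lra.
Qed.

(** The empty sum counts, so this is the running maximum of 0 and the partial sums; applied to [- d]
    it records the running minimum. *)
Fixpoint runmax d n : R :=
  if n is k.+1 then Num.max (runmax d k) (\sum_(i < k.+1) d i) else 0.

Lemma runmax_ge0 d n : 0 <= runmax d n.
Proof. by elim: n => //= n IH; rewrite le_max IH. Qed.

Lemma runmax_ge d k n : (k <= n)%N -> \sum_(i < k) d i <= runmax d n.
Proof.
elim: n => [|n IH]; first by rewrite leqn0 => /eqP ->; rewrite big_ord0.
rewrite leq_eqVlt => /predU1P[->|]; first by rewrite [leRHS]/= le_max lexx orbT.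
by rewrite ltnS => /IH kn; rewrite /= le_max kn.
Qed.

Lemma sqr_sum d n : (\sum_(i < n) d i) ^+ 2 =
  \sum_(i < n) d i ^+ 2 + 2 * \sum_(i < n) (\sum_(j < i) d j) * d i.
Proof.
elim: n => [|n IH]; first by rewrite !big_ord0; ring.
by rewrite !big_ord_recr /= sqrrD IH; ring.
Qed.

(** By Abel summation the bracket is the sum of [(M_(i+1) - M_i) s_(i+1)]. The maximum moves only
    when it equals the new partial sum, so each term is [(M_(i+1) - M_i) M_(i+1)], at least half the
    increment of [M^2]. *)
Lemma runmax_abel d n : runmax d n ^+ 2 <=
  2 * (runmax d n * \sum_(i < n) d i - \sum_(i < n) runmax d i * d i).
Proof.
elim: n => [|n IH]; first by rewrite !big_ord0 /=; lra.
rewrite /= !big_ord_recr /=.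
move: IH; set M := runmax d n; set s := \sum_(i < n) d i.
set I := \sum_(i < n) _; set t := d n => IH.
case: (leP M (s + t)) => h; last lra.
have := sqr_ge0 (s + t - M); nra.
Qed.

(** The integrand in [sqdev_le]: 16 comes from expanding [8 s^2] by [sqr_sum], each 4 from
    [runmax_abel], for [d] and for [- d]. *)
Definition doob_weight d n : R :=
  16 * \sum_(i < n) d i - 4 * runmax d n + 4 * runmax (fun i => - d i) n.

Definition sqdev d n : R := runmax d n ^+ 2 + runmax (fun i => - d i) n ^+ 2.

(* Pathwise form of Doob's L2 maximal inequality: the second sum is a
   martingale transform, as [doob_weight d i] only depends on [d j], [j < i]. *)
Lemma sqdev_le d n :
  sqdev d n <= 8 * \sum_(i < n) d i ^+ 2 + \sum_(i < n) doob_weight d i * d i.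
Proof.
have := runmax_abel d n; have := runmax_abel (fun i => - d i) n.
rewrite /sqdev /doob_weight sumrN; set M := runmax d n; set N := runmax _ n.
have -> : \sum_(i < n) runmax (fun i => - d i) i * - d i =
    - \sum_(i < n) runmax (fun i => - d i) i * d i.
  by rewrite -sumrN; apply: eq_bigr => i _; rewrite mulrN.
have := sqr_sum d n; set s := \sum_(i < n) d i.
have -> : \sum_(i < n) (16 * (\sum_(i0 < i) d i0) - 4 * runmax d i
     + 4 * runmax (fun i0 => - d i0) i) * d i =
  16 * (\sum_(i < n) (\sum_(j < i) d j) * d i) - 4 * (\sum_(i < n) runmax d i * d i)
  + 4 * \sum_(i < n) runmax (fun i => - d i) i * d i.
  rewrite !big_distrr /= -sumrN -!big_split /=; apply: eq_bigr => i _; ring.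
(* [4 M s <= M^2 + 4 s^2] turns twice [runmax_abel] into [M^2 <= 4 s^2 - 4 sum M_i d_i]; likewise
   for [N] with [- s]. *)
have := sqr_ge0 (M - 2 * s); have := sqr_ge0 (N + 2 * s).
rewrite !expr2; nra.
Qed.

Lemma sqr_sum_le_sqdev d k n : (k <= n)%N -> (\sum_(i < k) d i) ^+ 2 <= sqdev d n.
Proof.
move=> kn; have := runmax_ge d kn; have := runmax_ge (fun i => - d i) kn.
have := runmax_ge0 d n; have := runmax_ge0 (fun i => - d i) n.
rewrite sumrN /sqdev; set s := \sum_(i < k) _; set M := runmax d n.
set N := runmax _ n => N0 M0 hN hM.
have := sqr_ge0 M; have := sqr_ge0 N.
by case: (leP 0 s) => s0; nra.
Qed.

Lemma sqdev_ge0 d n : 0 <= sqdev d n.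
Proof. by rewrite addr_ge0 ?sqr_ge0. Qed.

Lemma sqdev_homo d : {homo sqdev d : k n / (k <= n)%N >-> k <= n}.
Proof.
apply: homo_leq => [//|x y z /le_trans|n]; first exact.
by apply: lerD; rewrite lerXn2r ?nnegrE ?runmax_ge0//= le_max lexx.
Qed.

(** With [T] the partial sums of [y i / a i], summation by parts gives [a n * T n.+1] minus the sum
    over [i < n] of [(a i.+1 - a i) * T i.+1]. As [a] is nondecreasing, each of the two is at most
    [e * a n]. *)
Lemma kronecker_bound a y (e : R) n : (forall k, 1 <= a k) ->
  {homo a : k n / (k <= n)%N >-> k <= n} ->
  (forall k, `|\sum_(i < k) y i / a i| <= e) ->
  `|\sum_(i < n.+1) y i| <= 2 * e * a n.
Proof.
move=> a1 ah hT; set T := fun k => \sum_(i < k) y i / a i.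
have hS : `|\sum_(i < n.+1) y i - a n * T n.+1| <= e * (a n - a 0).
  elim: n => [|n IH].
    rewrite /T !big_ord1 mulrC divfK ?subrr ?normr0 ?mulr0//.
    by rewrite gt_eqF// (lt_le_trans ltr01).
  have -> : T n.+2 = T n.+1 + y n.+1 / a n.+1 by rewrite /T big_ord_recr.
  rewrite big_ord_recr /=.
  have -> : \sum_(i < n.+1) y i + y n.+1 - a n.+1 * (T n.+1 + y n.+1 / a n.+1) =
      (\sum_(i < n.+1) y i - a n * T n.+1) - (a n.+1 - a n) * T n.+1.
    by field; rewrite gt_eqF// (lt_le_trans ltr01).
  apply: (le_trans (ler_normB _ _)); rewrite normrM.
  have an : 0 <= a n.+1 - a n by rewrite subr_ge0 ah.
  have := hT n.+1; rewrite (ger0_norm an) -/(T _); nra.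
have -> : \sum_(i < n.+1) y i = (\sum_(i < n.+1) y i - a n * T n.+1) + a n * T n.+1 by ring.
apply: (le_trans (ler_normD _ _)); rewrite normrM.
have := hT n.+1; rewrite -/(T n.+1) => h1.
have e0 : 0 <= e by apply: le_trans h1.
have an := a1 n; have a0 := a1 0%N; have ->: `|a n| = a n by rewrite ger0_norm; lra.
nra.
Qed.

(** The constant [B] absorbs any fixed number of initial terms; once [a] tends to infinity this says
    that [u = o(a)]. *)
Definition negligible_wrt a (u : nat -> R) :=
  forall e, 0 < e -> exists B, forall n, `|u n| <= B + e * a n.

Lemma negligible_wrtD a (s t : nat -> R) : negligible_wrt a s -> negligible_wrt a t ->
  negligible_wrt a (fun n => s n + t n).
Proof.
move=> hs ht e e0; have e2 : 0 < e / 2 by rewrite divr_gt0.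
have [B hB] := hs _ e2; have [C hC] := ht _ e2.
exists (B + C) => n; apply: le_trans (ler_normD _ _) _.
have := hB n; have := hC n; lra.
Qed.

Lemma bounded_negligible_wrt a (s : nat -> R) B : (forall n, 1 <= a n) ->
  (forall n, `|s n| <= B) -> negligible_wrt a s.
Proof.
move=> a1 hB e e0; exists B => n; apply: le_trans (hB n) _.
have := a1 n; nra.
Qed.

Lemma negligible_wrt_cvg a (s : nat -> R) : (forall n, 1 <= a n) -> a @ \oo --> +oo ->
  negligible_wrt a s -> (fun n => s n / a n) @ \oo --> 0.
Proof.
move=> a1 aoo hs; apply/cvgrPdist_le => e e0.
have e2 : 0 < e / 2 by rewrite divr_gt0.
have [B hB] := hs _ e2.
have /cvgryPge/(_ (B / (e / 2))) hA := aoo.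
near=> n; rewrite sub0r normrN normrM normfV.
have an := a1 n; have ->: `|a n| = a n by rewrite ger0_norm; lra.
rewrite ler_pdivrMr; last lra.
have := hB n.
have : B / (e / 2) <= a n by near: n.
rewrite ler_pdivrMr; last lra.
lra.
Unshelve. all: by end_near. Qed.

Lemma sum_eventually0 (z : nat -> R) m n : (forall i, (m <= i)%N -> z i = 0) ->
  `|\sum_(i < n) z i| <= \sum_(i < m) `|z i|.
Proof.
move=> z0; apply: le_trans (ler_norm_sum _ _ _) _.
elim: n => [|n IH]; first by rewrite big_ord0 sumr_ge0.
case: (leqP m n) => mn; first by rewrite big_ord_recr /= z0// normr0 addr0.
rewrite -[leRHS](big_mkord xpredT (fun i => `|z i|)).
rewrite (big_cat_nat (n := n.+1))//= big_mkord lerDl.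
by rewrite sumr_ge0.
Qed.

(** If the partial sums after every [m j] exceeded [e / 2] somewhere, each [j] would contribute
    [(e / 2)^2] to the bounded sum. So after some [m j] they all stay within [e / 2], and
    [kronecker_bound] applies. *)
Lemma sqdev_bounded_negligible a y (m : nat -> nat) B : (forall k, 1 <= a k) ->
  {homo a : k n / (k <= n)%N >-> k <= n} ->
  (forall K, \sum_(j < K) sqdev (from (m j) (fun k => y k / a k)) K <= B) ->
  negligible_wrt a (fun n => \sum_(i < n.+1) y i).
Proof.
move=> a1 ah hB e e0.
pose d := fun k => y k / a k.
have [j hj] : exists j, forall k, `|\sum_(i < k) from (m j) d i| <= e / 2.
  apply: contrapT => /forallNP hN.
  have hk j : {k | e / 2 < `|\sum_(i < k) from (m j) d i|}.
    apply: cid; apply: contrapT => /forallNP h; apply: (hN j) => k.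
    by rewrite leNgt; apply/negP/h.
  (* [J] contributions of [(e / 2)^2] exceed [B]; [K] is at least [J] and at least each of the first
     [J] exit times. *)
  pose J := (Num.truncn (B / (e / 2) ^+ 2)).+1.
  pose K := (J + \sum_(j < J) sval (hk j))%N.
  have := hB K; apply/negP; rewrite -ltNge.
  have e2 : 0 < (e / 2) ^+ 2 by rewrite exprn_gt0// divr_gt0.
  have : B < J%:R * (e / 2) ^+ 2.
    by rewrite -ltr_pdivrMr// truncnS_gt.
  move=> /lt_le_trans; apply.
  have JK : (J <= K)%N by rewrite leq_addr.
  rewrite -(big_mkord xpredT (fun j => sqdev (from (m j) d) K)).
  rewrite (big_cat_nat _ (n := J))//= big_mkord.
  apply: ler_wpDr; first by apply: sumr_ge0 => i _; exact: sqdev_ge0.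
  rewrite -[X in X%:R * _]card_ord -sum1_card natr_sum mulr_suml.
  apply: ler_sum => i _; rewrite mul1r.
  have iK : (sval (hk i) <= K)%N.
    by rewrite /K (bigD1 i)//= addnCA leq_addr.
  apply: le_trans (sqr_sum_le_sqdev _ iK).
  rewrite -[leRHS]real_normK ?num_real//.
  rewrite lerXn2r ?nnegrE ?divr_ge0 ?(ltW e0)//.
  exact: ltW (svalP (hk i)).
exists (\sum_(i < m j) `|y i|) => n.
have -> : \sum_(i < n.+1) y i = \sum_(i < n.+1) from (m j) y i
    + \sum_(i < n.+1) (y i - from (m j) y i).
  by rewrite -big_split /=; apply: eq_bigr => i _; ring.
rewrite addrC; apply: le_trans (ler_normD _ _) _; apply: lerD.
  apply: (le_trans (@sum_eventually0 (fun i => y i - from (m j) y i) (m j) _ _)).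
    by move=> i mi; rewrite /from mi subrr.
  by apply: ler_sum => i _; rewrite /from leqNgt ltn_ord subr0.
have := @kronecker_bound a (from (m j) y) (e / 2) n a1 ah.
rewrite mulrCA divff ?mulr1//; apply => k.
have -> : \sum_(i < k) from (m j) y i / a i = \sum_(i < k) from (m j) d i => //.
by apply: eq_bigr => i _; rewrite /from /d; case: ifP => //; rewrite mul0r.
Qed.

Definition clamp (c t : R) : R := Num.max (- c) (Num.min c t).

Lemma clamp_cases c t : 0 <= c ->
  [\/ t <= - c /\ clamp c t = - c, - c <= t <= c /\ clamp c t = t |
      c <= t /\ clamp c t = c].
Proof.
move=> c0; rewrite /clamp; case: (leP c t) => h1.
  by apply: Or33; split=> //; apply/max_idPr; lra.
case: (leP (- c) t) => h2; first by apply: Or32; split=> //; rewrite ltW.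
by apply: Or31; rewrite ltW.
Qed.

Lemma norm_clamp_le c t : 0 <= c -> `|clamp c t| <= c.
Proof.
move=> c0; rewrite ler_norml; apply/andP.
by case: (clamp_cases t c0) => -[? ->]; split; lra.
Qed.

Lemma clamp_id c t : `|clamp c t| < c -> clamp c t = t.
Proof.
move=> h; have c0 : 0 <= c by apply: le_trans (ltW h).
by move: h; rewrite ltr_norml => /andP[]; case: (clamp_cases t c0) => -[? ->]; lra.
Qed.

Lemma clamp_lip c s t : 0 <= c -> `|clamp c s - clamp c t| <= `|s - t|.
Proof.
move=> c0; have := ler_norm (s - t); have := ler_norm (- (s - t)).
rewrite normrN => h1 h2; rewrite ler_norml; apply/andP.
by case: (clamp_cases s c0) => -[? ->]; case: (clamp_cases t c0) => -[? ->]; split; lra.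
Qed.

Lemma clamp_sqr_le c t : 0 <= c -> clamp c t ^+ 2 <= t ^+ 2.
Proof. by move=> c0; case: (clamp_cases t c0) => -[? ->]; nra. Qed.

(** The clamp acts only when [|t| >= c], and there [|t| <= t^2 / c]. Being pointwise, this bounds
    truncation errors by second moments under a sub-linear expectation. *)
Lemma clamp_dist c t : 0 < c -> `|t - clamp c t| <= c^-1 * t ^+ 2.
Proof.
move=> c0; rewrite mulrC ler_pdivlMr//.
case: (clamp_cases t (ltW c0)) => -[? ->].
- by rewrite ler0_norm; nra.
- by rewrite subrr normr0 mul0r sqr_ge0.
- by rewrite ger0_norm; nra.
Qed.

(** This stands in for Borel-Cantelli: a bounded sum of squares makes the tail terms at most 1/2, so
    [|clamp (c k) (X k)| < c k] and the clamp is eventually inactive. *)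
Lemma clamp_sum_bounded (c X : nat -> R) B : (forall k, 0 < c k) ->
  (forall K, \sum_(k < K) (clamp (c k) (X k) / c k) ^+ 2 <= B) ->
  exists C, forall n, `|\sum_(i < n) (X i - clamp (c i) (X i))| <= C.
Proof.
move=> c0 hB.
have [m hm] := @small_tail (fun k => (clamp (c k) (X k) / c k) ^+ 2) B (1 / 2)
  (fun k => sqr_ge0 _) hB ltac:(lra).
exists (\sum_(i < m) `|X i - clamp (c i) (X i)|) => n.
apply: (@sum_eventually0 (fun i => X i - clamp (c i) (X i))) => i mi.
rewrite clamp_id ?subrr//.
have := hm i.+1; rewrite big_ord_recr /= {2}/from mi.
have : 0 <= \sum_(j < i) from m (fun k => (clamp (c k) (X k) / c k) ^+ 2) j.
  by apply: sumr_ge0 => j _; rewrite /from; case: ifP => // _; exact: sqr_ge0.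
move=> h1 h2; have {h1 h2} : (clamp (c i) (X i) / c i) ^+ 2 <= 1 / 2 by lra.
rewrite -real_normK ?num_real// normrM normfV (gtr0_norm (c0 i)) => h.
rewrite -[ltRHS]mul1r -ltr_pdivrMr//.
have := normr_ge0 (clamp (c i) (X i)); move: h; have ci := c0 i.
rewrite ltNge => h h'; apply/negP => h2; move: h h2; set t := `|_| / _; nra.
Qed.

End RealSequences.

(** * Calculus of a sub-linear expectation *)

Section SublinearExpectation.
Context {R : realType} {Omega : Type} (H : set (Omega -> R)) (E : (Omega -> R) -> \bar R).
Context (sl : sublinear_space H E).
Implicit Types (X Y Z U V W : Omega -> R).

Lemma H_comp1 X (f : R -> R) (C : R) (m : nat) : H X ->
  (forall s t, `|f s - f t| <= C * (1 + `|s| ^+ m + `|t| ^+ m) * `|s - t|) ->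
  H (fun w => f (X w)).
Proof.
move=> HX hf; have := @H_comp _ _ _ _ sl 1 (fun=> X) (fun v => f (v ord0)).
apply=> //; exists C, m => x y; rewrite /nrm1 !big_ord1; exact: hf.
Qed.

Lemma H_lip X (f : R -> R) : H X -> (forall s t, `|f s - f t| <= `|s - t|) ->
  H (fun w => f (X w)).
Proof.
move=> HX hf; apply: (@H_comp1 X f 1 0) => // s t; apply: le_trans (hf s t) _.
by rewrite !expr0 ler_peMl ?normr_ge0//; lra.
Qed.

Lemma H_abs X : H X -> H (fun w => `|X w|).
Proof. by move=> HX; apply: H_lip => // s t; exact: ler_dist_dist. Qed.

Lemma H_sqr X : H X -> H (fun w => X w ^+ 2).
Proof.
move=> HX; apply: (@H_comp1 X (fun t => t ^+ 2) 1 1) => // s t.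
rewrite !expr1 subr_sqr normrM mulrC mul1r; apply: ler_wpM2r => //.
by apply: le_trans (ler_normD _ _) _; lra.
Qed.

Lemma H_cst (c : R) : H (fun=> c).
Proof.
have := @H_comp1 (fun=> 0) (fun=> c) 0 0 (H_zero sl); apply => s t.
by rewrite subrr normr0 !mul0r.
Qed.

Lemma H_opp X : H X -> H (fun w => - X w).
Proof.
by move=> HX; rewrite (_ : (fun w => _) = (fun w => -1 * X w));
  [exact: (H_scale sl) | apply/funext => w; rewrite mulN1r].
Qed.

(* [E] is only known to be finite on bounded functions, so that real-valued
   calculus with [e] is confined to [good] functions. *)
Definition good X := H X /\ (E (fun w => `|X w|%R) < +oo)%E.
Definition e X : R := fine (E X).

Lemma good_H X : good X -> H X. Proof. by case. Qed.

Lemma E_ge0 X : H X -> (forall w, 0 <= X w) -> (0%E <= E X)%E.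
Proof. by move=> HX X0; have := E_mono sl (H_cst 0) HX X0; rewrite (E_cst sl). Qed.

(** The value [-oo] is excluded by sub-additivity applied to [|X| - |X| = 0]: it would force
    [E (- |X|) = -oo] while [E |X|] is finite. *)
Lemma good_fin X : good X -> E X \is a fin_num.
Proof.
move=> [HX hX].
have h0 : (0%E <= E (fun w => `|X w|%R))%E by apply: E_ge0 => //; exact: H_abs.
have hle : (E X <= E (fun w => `|X w|%R))%E.
  by apply: (E_mono sl) => //; [exact: H_abs | move=> w; exact: ler_norm].
rewrite fin_numE; apply/andP; split; last first.
  by apply: contraTneq hX => h; rewrite -leNgt -h.
apply/eqP => hX'.
have hm : (E (fun w => - `|X w|)%R <= E X)%E.
  apply: (E_mono sl) => //; first exact/H_opp/H_abs.
  by move=> w; rewrite lerNl -normrN ler_norm.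
have hbad : E (fun w => - `|X w|)%R = -oo%E by apply/eqP; rewrite -leeNy_eq -hX'.
have hA : E (fun w => `|X w|)%R \is a fin_num by rewrite ge0_fin_numE.
have := @E_subadd _ _ _ _ sl _ _ (H_abs HX) (H_opp (H_abs HX)).
rewrite hbad -(fineK hA) => h; have {h} := h ltac:(by case) ltac:(by case).
by under eq_fun do rewrite subrr; rewrite (E_cst sl).
Qed.

Lemma eK X : good X -> E X = (e X)%:E.
Proof. by move=> /good_fin h; rewrite /e fineK. Qed.

Lemma good_le X Y : H X -> (forall w, `|X w| <= Y w) -> good Y -> good X.
Proof.
move=> HX hXY gY; split => //; apply: (@le_lt_trans _ _ (E Y)).
  by apply: (E_mono sl); [exact: H_abs | exact: good_H |].
by rewrite (eK gY) ltry.
Qed.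

Lemma good_cst (c : R) : good (fun=> c).
Proof. by split; [exact: H_cst | rewrite (E_cst sl) ltry]. Qed.

Lemma e_cst (c : R) : e (fun=> c) = c.
Proof. by rewrite /e (E_cst sl). Qed.

Lemma good_bounded X : H X -> Defs.bounded_fun X -> good X.
Proof. by move=> HX [M hM]; apply: (@good_le _ (fun=> M)) => //; exact: good_cst. Qed.

Lemma good_abs X : good X -> good (fun w => `|X w|).
Proof.
by case=> HX h; split; [exact: H_abs | under eq_fun do rewrite normr_id].
Qed.

Lemma E_fin_subadd X Y : good X -> good Y ->
  (E (fun w => X w + Y w)%R <= (e X + e Y)%:E)%E.
Proof.
move=> gX gY; rewrite EFinD -!eK//; apply: (E_subadd sl); try exact: good_H.
  by rewrite (eK gX); case.
by rewrite (eK gX); case.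
Qed.

Lemma goodD X Y : good X -> good Y -> good (fun w => X w + Y w).
Proof.
move=> gX gY; have HXY := H_add sl (good_H gX) (good_H gY); split=> //.
have h := E_fin_subadd (good_abs gX) (good_abs gY).
apply: le_lt_trans (ltry _); apply: le_trans h.
apply: (E_mono sl); [exact: H_abs | | by move=> w; exact: ler_normD].
by apply: (H_add sl); apply/H_abs/good_H.
Qed.

Lemma goodZ (c : R) X : good X -> good (fun w => c * X w).
Proof.
move=> gX; split; first exact/(H_scale sl)/good_H.
have [->|c0] := eqVneq c 0.
  by under eq_fun do rewrite mul0r normr0; rewrite (E_cst sl) ltry.
under eq_fun do rewrite normrM.
rewrite (E_homog sl) ?normr_gt0//; last exact/H_abs/good_H.
by rewrite (eK (good_abs gX)) -EFinM ltry.
Qed.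

Lemma goodN X : good X -> good (fun w => - X w).
Proof. by move=> /(goodZ (-1)); under eq_fun do rewrite mulN1r. Qed.

Lemma good_sum n (X : nat -> Omega -> R) : (forall i, good (X i)) ->
  good (fun w => \sum_(i < n) X i w).
Proof.
move=> gX; elim: n => [|n IH].
  by under eq_fun do rewrite big_ord0; exact: good_cst.
by under eq_fun do rewrite big_ord_recr /=; exact: goodD.
Qed.

Lemma e_mono X Y : good X -> good Y -> (forall w, X w <= Y w) -> e X <= e Y.
Proof.
by move=> gX gY h; rewrite -lee_fin -!eK//; apply: (E_mono sl) => //; exact: good_H.
Qed.

Lemma eD X Y : good X -> good Y -> e (fun w => X w + Y w) <= e X + e Y.
Proof.
by move=> gX gY; rewrite -lee_fin -eK; [exact: E_fin_subadd | exact: goodD].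
Qed.

Lemma eZ (c : R) X : 0 <= c -> good X -> e (fun w => c * X w) = c * e X.
Proof.
rewrite le_eqVlt => /predU1P[<-|c0] gX.
  by under eq_fun do rewrite mul0r; rewrite e_cst mul0r.
by rewrite /e (E_homog sl)// ?(eK gX) //; exact: good_H.
Qed.

Lemma eDc X (c : R) : good X -> e (fun w => X w + c) = e X + c.
Proof.
move=> gX; apply/eqP; rewrite eq_le; apply/andP; split.
  by have := eD gX (good_cst c); rewrite e_cst.
have := eD (goodD gX (good_cst c)) (good_cst (- c)); rewrite e_cst.
by under eq_fun do rewrite addrK; lra.
Qed.

Lemma e_sum n (X : nat -> Omega -> R) : (forall i, good (X i)) ->
  e (fun w => \sum_(i < n) X i w) <= \sum_(i < n) e (X i).
Proof.
move=> gX; elim: n => [|n IH].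
  by under eq_fun do rewrite big_ord0; rewrite e_cst big_ord0.
under eq_fun do rewrite big_ord_recr /=.
by rewrite big_ord_recr /=; apply: le_trans (eD (good_sum n gX) (gX n)) _; rewrite lerD2r.
Qed.

Lemma e_ge0 X : good X -> (forall w, 0 <= X w) -> 0 <= e X.
Proof. by move=> gX X0; rewrite -(e_cst 0); apply: e_mono => //; exact: good_cst. Qed.

Lemma eN_ge0 X : good X -> 0 <= e X + e (fun w => - X w).
Proof.
move=> gX; have := eD gX (goodN gX); under eq_fun do rewrite subrr.
by rewrite e_cst.
Qed.

Lemma e_lip X Y Z : good X -> good Y -> good Z -> (forall w, `|X w - Y w| <= Z w) ->
  `|e X - e Y| <= e Z.
Proof.
move=> gX gY gZ h.
have h1 : e X <= e Y + e Z.
  apply: le_trans (eD gY gZ); apply: e_mono => //; first exact: goodD.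
  by move=> w; have := h w; rewrite ler_norml => /andP[]; lra.
have h2 : e Y <= e X + e Z.
  apply: le_trans (eD gX gZ); apply: e_mono => //; first exact: goodD.
  by move=> w; have := h w; rewrite ler_norml => /andP[]; lra.
by rewrite ler_norml; apply/andP; split; lra.
Qed.

Lemma good_sqr X : H X -> good (fun w => X w ^+ 2) -> good X.
Proof.
move=> HX gX; apply: (@good_le _ (fun w => X w ^+ 2 + 1)) => //; last first.
  by apply: goodD => //; exact: good_cst.
move=> w; rewrite -(real_normK (num_real (X w))).
have := normr_ge0 (X w); nra.
Qed.

(** A Jensen inequality by tangent lines: [2 s x <= x^2 + s^2] for every [s]. The sign of [s]
    decides whether the upper or the lower mean bounds [m]; then take [s = m]. *)
Lemma sqr_e_le X (m : R) : good X -> good (fun w => X w ^+ 2) ->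
  - e (fun w => - X w) <= m <= e X -> m ^+ 2 <= e (fun w => X w ^+ 2).
Proof.
move=> gX gX2 /andP[h1 h2].
have key (s : R) : 2 * s * m <= e (fun w => X w ^+ 2) + s ^+ 2.
  rewrite -(eDc _ gX2); have g2 := goodD gX2 (good_cst (s ^+ 2)).
  case: (leP 0 s) => s0.
    apply: (@le_trans _ _ (2 * s * e X)); first by nra.
    rewrite -eZ ?mulr_ge0//; apply: e_mono => //; first exact: goodZ.
    by move=> w; have := sqr_ge0 (X w - s); nra.
  apply: (@le_trans _ _ (2 * - s * e (fun w => - X w))); first by nra.
  rewrite -eZ ?mulr_ge0//; [|lra|exact: goodN].
  apply: e_mono => //; first exact/goodZ/goodN.
  by move=> w; have := sqr_ge0 (X w - s); nra.
by have := key m; nra.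
Qed.

End SublinearExpectation.

(** * Independence and martingale transforms *)

Section BoundedLipschitz.
Context {R : realType} {d : nat}.
Implicit Types (phi psi : ('I_d -> R) -> R).

Lemma nrm1_ge0 (x : 'I_d -> R) : 0 <= nrm1 x.
Proof. by apply: sumr_ge0. Qed.

Lemma bdd_lip_ge0 phi : bdd_lip phi -> exists C M : R,
  [/\ 0 <= C, 0 <= M, forall x y, `|phi x - phi y| <= C * nrm1 (fun i => x i - y i)
    & forall x, `|phi x| <= M].
Proof.
move=> [[C hC] [M hM]]; exists `|C|, `|M|; split => // [x y|x].
  by apply: le_trans (hC x y) _; rewrite ler_wpM2r ?nrm1_ge0 ?ler_norm.
by apply: le_trans (hM x) _; exact: ler_norm.
Qed.

Lemma bdd_lip_loclip phi : bdd_lip phi -> loclip_poly phi.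
Proof.
move=> /bdd_lip_ge0[C [M [C0 M0 hC hM]]]; exists C, 0 => x y.
apply: le_trans (hC x y) _; rewrite !expr0 ler_wpM2r ?nrm1_ge0//; lra.
Qed.

Lemma bdd_lip_cst (c : R) : bdd_lip (fun _ : 'I_d -> R => c).
Proof. by split; [exists 0 => x y; rewrite subrr normr0 mul0r | exists `|c|]. Qed.

Lemma bdd_lipD phi psi : bdd_lip phi -> bdd_lip psi -> bdd_lip (fun x => phi x + psi x).
Proof.
move=> [[C hC] [M hM]] [[C' hC'] [M' hM']]; split.
  exists (C + C') => x y; rewrite opprD addrACA mulrDl.
  by apply: le_trans (ler_normD _ _) _; exact: lerD.
by exists (M + M') => x; apply: le_trans (ler_normD _ _) _; exact: lerD.
Qed.

Lemma bdd_lipM phi psi : bdd_lip phi -> bdd_lip psi -> bdd_lip (fun x => phi x * psi x).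
Proof.
move=> /bdd_lip_ge0[C [M [C0 M0 hC hM]]] /bdd_lip_ge0[C' [M' [C0' M0' hC' hM']]]; split.
  exists (C * M' + M * C') => x y.
  have -> : phi x * psi x - phi y * psi y =
    (phi x - phi y) * psi x + phi y * (psi x - psi y) by ring.
  apply: le_trans (ler_normD _ _) _; rewrite !normrM mulrDl; apply: lerD.
    by rewrite mulrAC ler_pM.
  by rewrite -mulrA ler_pM.
by exists (M * M') => x; rewrite normrM ler_pM.
Qed.

Lemma bdd_lip_max phi psi : bdd_lip phi -> bdd_lip psi ->
  bdd_lip (fun x => Num.max (phi x) (psi x)).
Proof.
move=> /bdd_lip_ge0[C [M [C0 M0 hC hM]]] /bdd_lip_ge0[C' [M' [C0' M0' hC' hM']]]; split.
  exists (C + C') => x y; apply: (@le_trans _ _ (`|phi x - phi y| + `|psi x - psi y|)).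
    have := ler_norm (phi x - phi y); have := ler_norm (psi x - psi y).
    have := ler_norm (- (phi x - phi y)); have := ler_norm (- (psi x - psi y)).
    rewrite !normrN => *; rewrite ler_norml; apply/andP.
    by case: (leP (phi x) (psi x)) => ?; case: (leP (phi y) (psi y)) => ?; split; lra.
  by rewrite mulrDl; apply: lerD.
exists (M + M') => x; have := hM x; have := hM' x.
by case: (leP (phi x) (psi x)) => ?; lra.
Qed.

Lemma bdd_lip_clamp_coord (c : R) (i : 'I_d) : 0 <= c ->
  bdd_lip (fun x : 'I_d -> R => clamp c (x i)).
Proof.
move=> c0; split; last by exists c => x; exact: norm_clamp_le.
exists 1 => x y; rewrite mul1r; apply: le_trans (clamp_lip _ _ c0) _.
by rewrite /nrm1 (bigD1 i)//= lerDl sumr_ge0.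
Qed.

End BoundedLipschitz.

Section Predictable.
Context {R : realType} {Omega : Type} (Y : nat -> Omega -> R) (c : nat -> R).
Context (c_ge0 : forall n, 0 <= c n) (Yc : forall n w, `|Y n w| <= c n).
Implicit Types (U V : Omega -> R) (d : nat).

(** The substitute for measurability with respect to the past before time [d]: exactly the
    functionals that can be used to test independence. *)
Definition bounded_lipschitz_in d U :=
  exists2 phi : ('I_d -> R) -> R, bdd_lip phi & forall w, U w = phi (fun i => Y i w).
Local Notation nice := bounded_lipschitz_in.

Lemma nice_cst d (r : R) : nice d (fun=> r).
Proof. by exists (fun=> r) => //; exact: bdd_lip_cst. Qed.

Lemma niceD d U V : nice d U -> nice d V -> nice d (fun w => U w + V w).
Proof.
move=> [f hf Uf] [g hg Vg]; exists (fun x => f x + g x); first exact: bdd_lipD.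
by move=> w; rewrite Uf Vg.
Qed.

Lemma niceM d U V : nice d U -> nice d V -> nice d (fun w => U w * V w).
Proof.
move=> [f hf Uf] [g hg Vg]; exists (fun x => f x * g x); first exact: bdd_lipM.
by move=> w; rewrite Uf Vg.
Qed.

Lemma nice_max d U V : nice d U -> nice d V -> nice d (fun w => Num.max (U w) (V w)).
Proof.
move=> [f hf Uf] [g hg Vg]; exists (fun x => Num.max (f x) (g x)); first exact: bdd_lip_max.
by move=> w; rewrite Uf Vg.
Qed.

Lemma niceN d U : nice d U -> nice d (fun w => - U w).
Proof. by move=> /(niceM (nice_cst d (-1))); under eq_fun do rewrite mulN1r. Qed.

Lemma nice_X d U n : nice d U -> nice d (fun w => U w ^+ n).
Proof.
move=> hU; elim: n => [|n IH]; first by under eq_fun do rewrite expr0; exact: nice_cst.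
by under eq_fun do rewrite exprS; exact: niceM.
Qed.

Lemma nice_sum d n (U : nat -> Omega -> R) :
  (forall i, (i < n)%N -> nice d (U i)) -> nice d (fun w => \sum_(i < n) U i w).
Proof.
elim: n => [_|n IH hU]; first by under eq_fun do rewrite big_ord0; exact: nice_cst.
under eq_fun do rewrite big_ord_recr /=.
by apply: niceD; [apply: IH => i /ltnW; exact: hU | exact: hU].
Qed.

Lemma clamp_bounded_id n w : clamp (c n) (Y n w) = Y n w.
Proof.
have := Yc n w; rewrite ler_norml => /andP[h1 h2].
by rewrite /clamp (min_idPr h2) (max_idPr h1).
Qed.

(** A coordinate function is unbounded, but the clamp at [c i] is bounded and agrees with it on the
    values of [Y i]. *)
Lemma nice_coord d i : (i < d)%N -> nice d (Y i).
Proof.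
move=> id; exists (fun x => clamp (c i) (x (Ordinal id))).
  exact: bdd_lip_clamp_coord.
by move=> w; rewrite /= clamp_bounded_id.
Qed.

Lemma nice_widen d d' U : (d <= d')%N -> nice d U -> nice d' U.
Proof.
move=> dd' [f hf Uf].
exists (fun x => f (fun i => x (widen_ord dd' i))); last first.
  by move=> w; rewrite Uf.
move: hf => /bdd_lip_ge0[C [M [C0 M0 hC hM]]]; split; last by exists M.
exists C => x y; apply: le_trans (hC _ _) _; rewrite ler_wpM2l// /nrm1.
pose z i := if insub i is Some j then `|x j - y j| else 0 : R.
have -> : \sum_(i < d') `|x i - y i| = \sum_(i < d') z i.
  by apply: eq_bigr => i _; rewrite /z valK.
have -> : \sum_(i < d) `|x (widen_ord dd' i) - y (widen_ord dd' i)| = \sum_(i < d) z i.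
  apply: eq_bigr => i _; rewrite /z (_ : nat_of_ord i = widen_ord dd' i)// valK//.
rewrite -!(big_mkord xpredT) [leRHS](big_cat_nat (n := d))//= lerDl.
by apply: sumr_ge0 => i _; rewrite /z; case: insub.
Qed.

Context (H : set (Omega -> R)) (E : (Omega -> R) -> \bar R).
Context (sl : sublinear_space H E) (HY : forall n, H (Y n)) (indY : indep_seq E Y).
Local Notation good := (good H E).
Local Notation e := (e E).

Lemma nice_H d U : nice d U -> H U.
Proof.
move=> [f hf Uf]; rewrite (_ : U = fun w => f (fun i => Y i w)); last exact/funext.
by apply: (H_comp sl) => //; exact: bdd_lip_loclip.
Qed.

Lemma nice_bounded d U : nice d U -> Defs.bounded_fun U.
Proof. by move=> [f [_ [M hM]] Uf]; exists M => w; rewrite Uf. Qed.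

Lemma nice_good d U : nice d U -> good U.
Proof. by move=> hU; apply: (good_bounded sl (nice_H hU)); exact: nice_bounded hU. Qed.

Lemma goodY n : good (Y n).
Proof. by apply: (@nice_good n.+1); exact: nice_coord. Qed.

(** Only nonnegative factors leave [e], so [r] is split into positive and negative parts; writing
    them with [max] keeps the result bounded Lipschitz when [r] and [u] depend on the past. *)
Lemma e_affine (r u : R) V : good V ->
  e (fun w => u + r * V w) = Num.max r 0 * e V + Num.max (- r) 0 * e (fun w => - V w) + u.
Proof.
move=> gV; under eq_fun do rewrite addrC.
rewrite (eDc sl); last exact: goodZ; congr (_ + _).
case: (leP 0 r) => r0.
  by rewrite (max_idPr _) ?oppr_le0// mul0r addr0 (eZ sl).
rewrite mul0r add0r (max_idPl _) ?oppr_ge0 ?ltW// -(eZ sl) ?oppr_ge0 ?ltW//.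
  by congr e; apply/funext => w; rewrite mulrNN.
exact: goodN.
Qed.

(** With the past frozen, the expectation of [U + h D] is [g = U + h^+ e(D) + h^- e(-D)]. Both
    expectations are nonnegative, so [g >= U], and independence identifies [e g] with the right-hand
    side. *)
Lemma e_indep_increment n U h (r s : R) : nice n U -> nice n h ->
  0 <= e (fun w => r * Y n w + s) -> 0 <= e (fun w => - (r * Y n w + s)) ->
  e U <= e (fun w => U w + h w * (r * Y n w + s)).
Proof.
set D := fun w => r * Y n w + s => hU hh D1 D2.
have gD : good D by apply: (goodD sl); [apply: goodZ => //; exact: goodY | exact: good_cst].
pose g w := Num.max (h w) 0 * e D + Num.max (- h w) 0 * e (fun w => - D w) + U w.
have hg : nice n g.
  by do ?[apply: niceD|apply: niceM|apply: nice_max|apply: niceN|exact: nice_cst].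
have leg : e U <= e g.
  apply: (e_mono sl); [exact: nice_good hU | exact: nice_good hg |] => w.
  by rewrite /g lerDr addr_ge0 ?mulr_ge0// le_max lexx orbT.
suff -> : e (fun w => U w + h w * D w) = e g by [].
(* [indep_seq] says nothing at index 0; there the past is empty, so [U] and [h] are constants. *)
have [n0|n0] := posnP n.
  have hc V : nice n V -> exists v, forall w, V w = v.
    move=> [f _ Vf]; exists (f (fun=> 0)) => w; rewrite Vf; congr f.
    by apply/funext => -[i]; rewrite n0.
  have [u hu] := hc _ hU; have [k hk] := hc _ hh.
  rewrite (_ : (fun w => _) = (fun w => u + k * D w)); last first.
    by apply/funext => w; rewrite hu hk.
  rewrite (_ : g = (fun=> e (fun w => u + k * D w))) ?(e_cst sl)//.
  by apply/funext => w; rewrite e_affine// /g hu hk.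
have [f hf Uf] := hU; have [k hk hK] := hh.
(* The product is unbounded in [y]; clamping makes it a legitimate test function without changing
   its values at [Y n]. *)
pose phi (x : 'I_n -> R) y := f x + k x * (r * clamp (c n) y + s).
have hphi : bdd_lip2 phi.
  move: hf hk => /bdd_lip_ge0[C [M [C0 M0 hC hM]]] /bdd_lip_ge0[C' [M' [C0' M0' hC' hM']]].
  have hcl y : `|r * clamp (c n) y + s| <= `|r| * c n + `|s|.
    apply: le_trans (ler_normD _ _) _; rewrite lerD2r normrM ler_wpM2l//.
    exact: norm_clamp_le.
  split; last first.
    exists (M + M' * (`|r| * c n + `|s|)) => x y.
    apply: le_trans (ler_normD _ _) _; rewrite normrM; apply: lerD => //.
    by rewrite ler_pM.
  exists (C + C' * (`|r| * c n + `|s|) + M' * `|r|) => x x' y y'.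
  rewrite /phi; set t := nrm1 _; have t0 : 0 <= t by exact: nrm1_ge0.
  set b := _ + `|s|; have b0 : 0 <= b by rewrite addr_ge0// mulr_ge0.
  set z := r * _ + s; set z' := r * _ + s.
  have -> : f x + k x * z - (f x' + k x' * z') =
    (f x - f x') + (k x - k x') * z + k x' * (z - z') by ring.
  have zz : `|z - z'| <= `|r| * `|y - y'|.
    rewrite (_ : z - z' = r * (clamp (c n) y - clamp (c n) y')); last by rewrite /z /z'; ring.
    by rewrite normrM ler_wpM2l//; exact: clamp_lip.
  have h1 : `|f x - f x'| <= C * t by exact: hC.
  have h2 : `|(k x - k x') * z| <= C' * t * b by rewrite normrM ler_pM//; exact: hcl.
  have h3 : `|k x' * (z - z')| <= M' * (`|r| * `|y - y'|) by rewrite normrM ler_pM.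
  apply: le_trans (ler_normD _ _) _; apply: le_trans (lerD (ler_normD _ _) (lexx _)) _.
  have : 0 <= `|y - y'| by [].
  set q := `|y - y'| => q0.
  have C0b : 0 <= C' * b by exact: mulr_ge0.
  have M0r : 0 <= M' * `|r| by exact: mulr_ge0.
  have ? : 0 <= C * q by exact: mulr_ge0.
  have ? : 0 <= C' * b * q by exact: mulr_ge0.
  have ? : 0 <= M' * `|r| * t by exact: mulr_ge0.
  rewrite -/q in h3; lra.
have := indY n0 hphi.
rewrite (_ : (fun w => phi _ _) = (fun w => U w + h w * D w)); last first.
  by apply/funext => w; rewrite /phi clamp_bounded_id -Uf -hK.
move=> h1; rewrite /e h1; congr (fine (E _)); apply/funext => w.
rewrite /g -e_affine//; congr e; apply/funext => w'.
by rewrite /phi clamp_bounded_id -Uf -hK.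
Qed.

(** The two conditions place 0 between the lower and upper means of each increment; removing
    increments from the last one down can then only lower [e]. *)
Lemma e_martingale_transform (h : nat -> Omega -> R) (r s : nat -> R) n :
  (forall k, nice k (h k)) ->
  (forall k, 0 <= e (fun w => r k * Y k w + s k)) ->
  (forall k, 0 <= e (fun w => - (r k * Y k w + s k))) ->
  0 <= e (fun w => \sum_(k < n) h k w * (r k * Y k w + s k)).
Proof.
move=> hh D1 D2; elim: n => [|n IH].
  by under eq_fun do rewrite big_ord0; rewrite (e_cst sl).
apply: le_trans IH _; under [X in _ <= e X]eq_fun do rewrite big_ord_recr /=.
apply: e_indep_increment => //.
apply: (@nice_sum n n (fun k w => h k w * (r k * Y k w + s k))) => k kn.
apply: niceM; first exact: nice_widen (ltnW kn) (hh k).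
by apply: niceD; [apply: niceM; [exact: nice_cst | exact: nice_coord] | exact: nice_cst].
Qed.

Lemma e_sum_indep (r : R) n :
  e (fun w => \sum_(k < n) r * Y k w) = \sum_(k < n) e (fun w => r * Y k w).
Proof.
apply/eqP; rewrite eq_le; apply/andP; split.
  by apply: (@e_sum _ _ _ _ sl n (fun k w => r * Y k w)) => k; apply: goodZ => //; exact: goodY.
elim: n => [|n IH].
  by rewrite big_ord0; under eq_fun do rewrite big_ord0; rewrite (e_cst sl).
have gr : good (fun w => r * Y n w) by apply: goodZ => //; exact: goodY.
have hU : nice n (fun w => \sum_(k < n) r * Y k w).
  apply: (@nice_sum n n (fun k w => r * Y k w)) => k kn.
  by apply: niceM; [exact: nice_cst | exact: nice_coord].
rewrite big_ord_recr /=; under [X in _ <= e X]eq_fun do rewrite big_ord_recr /=.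
set m := e (fun w => r * Y n w).
(* Centring the last term at its upper mean [m] satisfies both conditions: the upper mean becomes 0,
   and that of the opposite is nonnegative by [eN_ge0]. *)
have := @e_indep_increment n _ (fun=> 1) r (- m) hU (nice_cst n 1).
have -> : (fun w => \sum_(k < n) r * Y k w + 1 * (r * Y n w - m)) =
    (fun w => (\sum_(k < n) r * Y k w + r * Y n w) + - m).
  by apply/funext => w; rewrite mul1r addrA.
rewrite !(eDc sl) ?subrr//; last first.
  by apply: (goodD sl) => //; exact: nice_good hU.
have -> : (fun w => - (r * Y n w - m)) = (fun w => - (r * Y n w) + m).
  by apply/funext => w; rewrite opprB addrC.
rewrite (eDc sl); last exact: goodN.
by have := eN_ge0 sl gr; rewrite -/m [m + _]addrC => h /(_ (lexx _) h); lra.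
Qed.

End Predictable.

(** * The energy functional of the oscillations and its lower expectation bound *)

Section Energy.
Context {R : realType} {Omega : Type} (Y : nat -> Omega -> R) (c : nat -> R).
Context (c_ge0 : forall n, 0 <= c n) (Yc : forall n w, `|Y n w| <= c n).
Context (m : nat -> nat) (r s : nat -> R).
Local Notation nice := (bounded_lipschitz_in Y).

Let incr w k := r k * Y k w + s k.

(* The first term controls the oscillation after time [m j] of the partial sums
   of the increments, for all [j] at once; the second one forces
   [|Y k| < c k] eventually. *)
Definition energy (K : nat) (w : Omega) : R :=
  \sum_(j < K) sqdev (from (m j) (incr w)) K + \sum_(k < K) (Y k w / c k) ^+ 2.

Lemma nice_incr d k : (k < d)%N -> nice d (fun w => incr w k).
Proof.
move=> kd; apply: niceD; last exact: nice_cst.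
by apply: niceM; [exact: nice_cst | exact: nice_coord kd].
Qed.

Lemma nice_from d j (f : Omega -> nat -> R) k : nice d (fun w => f w k) ->
  nice d (fun w => from j (f w) k).
Proof. by move=> h; rewrite /from; case: (j <= k)%N => //; exact: nice_cst. Qed.

Lemma nice_runmax d K (f : Omega -> nat -> R) :
  (forall k, (k < K)%N -> nice d (fun w => f w k)) -> nice d (fun w => runmax (f w) K).
Proof.
elim: K => [_|K IH hf /=]; first exact: nice_cst.
apply: nice_max; first by apply: IH => k /ltnW; exact: hf.
exact: (nice_sum (U := fun k w => f w k)).
Qed.

Lemma nice_doob_weight d K (f : Omega -> nat -> R) :
  (forall k, (k < K)%N -> nice d (fun w => f w k)) -> nice d (fun w => doob_weight (f w) K).
Proof.
move=> hf; rewrite /doob_weight; apply: niceD; first apply: niceD.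
- by apply: niceM; [exact: nice_cst | exact: (nice_sum (U := fun k w => f w k))].
- by apply: niceN; apply: niceM; [exact: nice_cst | exact: nice_runmax].
- apply: niceM; first exact: nice_cst.
  by apply: (@nice_runmax _ _ (fun w k => - f w k)) => k kK; apply: niceN; exact: hf.
Qed.

Lemma nice_sqdev d K (f : Omega -> nat -> R) :
  (forall k, (k < K)%N -> nice d (fun w => f w k)) -> nice d (fun w => sqdev (f w) K).
Proof.
move=> hf; rewrite /sqdev; apply: niceD; apply: nice_X; first exact: nice_runmax.
by apply: (@nice_runmax _ _ (fun w k => - f w k)) => k kK; apply: niceN; exact: hf.
Qed.

Lemma nice_energy K : nice K (energy K).
Proof.
apply: niceD.
  apply: (nice_sum (U := fun j w => sqdev (from (m j) (incr w)) K)) => j _.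
  by apply: (@nice_sqdev _ _ (fun w => from (m j) (incr w))) => k kK;
    apply: nice_from; exact: nice_incr.
apply: (nice_sum (U := fun k w => (Y k w / c k) ^+ 2)) => k kK; apply: nice_X.
by apply: niceM; [exact: nice_coord kK | exact: nice_cst].
Qed.

Lemma energy_ge0 K w : 0 <= energy K w.
Proof.
by apply: addr_ge0; apply: sumr_ge0 => i _; [exact: sqdev_ge0 | exact: sqr_ge0].
Qed.

Lemma energy_homo w : {homo energy ^~ w : k n / (k <= n)%N >-> k <= n}.
Proof.
apply: homo_leq => [//|x y z /le_trans|n]; first exact.
rewrite /energy !big_ord_recr /=; apply: lerD.
  apply: ler_wpDr; first exact: sqdev_ge0.
  by apply: ler_sum => i _; exact: sqdev_homo.
by rewrite lerDl sqr_ge0.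
Qed.

Context (H : set (Omega -> R)) (E : (Omega -> R) -> \bar R).
Context (sl : sublinear_space H E) (HY : forall n, H (Y n)) (indY : indep_seq E Y).
Local Notation e := (e E).

(** Summing [sqdev_le] over [j] gives, pathwise, a martingale transform at most [- energy + Q], with
    [Q] quadratic. Hence [0 <= e(- energy) + e(Q)], and [e(Q) <= 16 + B], where 16 is 8 times the
    sum of [2^-j]. *)
Lemma energy_lower_bound (v : nat -> R) (B : R) :
  (forall k, 0 <= e (fun w => incr w k)) ->
  (forall k, 0 <= e (fun w => - incr w k)) ->
  (forall k, e (fun w => incr w k ^+ 2) <= v k) ->
  (forall j n, \sum_(i < n) from (m j) v i <= 2^-1 ^+ j) ->
  (forall n, \sum_(k < n) e (fun w => (Y k w / c k) ^+ 2) <= B) ->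
  forall K, - (16 + B) <= e (fun w => - energy K w).
Proof.
move=> D1 D2 Dv hm hB K.
(* The pathwise inequalities for all [j] are merged into one transform; the sign is negative because
   [- energy] is bounded from below. *)
pose h k w := - \sum_(j < K) from (m j) (doob_weight (from (m j) (incr w))) k.
have nh k : nice k (h k).
  apply: niceN; apply: (nice_sum (U := fun j w =>
    from (m j) (doob_weight (from (m j) (incr w))) k)) => j _.
  apply: (@nice_from _ _ (fun w => doob_weight (from (m j) (incr w)))).
  apply: (@nice_doob_weight _ _ (fun w => from (m j) (incr w))) => i ik.
  by apply: nice_from; exact: nice_incr.
pose q j w := 8 * \sum_(k < K) from (m j) (fun k => incr w k ^+ 2) k.
pose b k w := (Y k w / c k) ^+ 2.
have gincr2 k : good H E (fun w => incr w k ^+ 2).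
  by apply: (@nice_good _ _ Y _ _ sl _ k.+1) => //; apply: nice_X; exact: nice_incr.
have gfrom j k : good H E (fun w => from (m j) (fun k => incr w k ^+ 2) k).
  by rewrite /from; case: (m j <= k)%N => //; exact: good_cst.
have gsq j : good H E (fun w => \sum_(k < K) from (m j) (fun k => incr w k ^+ 2) k).
  exact: (good_sum sl K (gfrom j)).
have gq j : good H E (q j) by exact: goodZ.
have gb k : good H E (b k).
  apply: (@nice_good _ _ Y _ _ sl _ k.+1) => //; apply: nice_X.
  by apply: niceM; [exact: nice_coord (ltnSn k) | exact: nice_cst].
pose Q w := \sum_(j < K) q j w + \sum_(k < K) b k w.
have gsumq : good H E (fun w => \sum_(j < K) q j w) by exact: good_sum.
have gsumb : good H E (fun w => \sum_(k < K) b k w) by exact: good_sum.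
have gQ : good H E Q by exact: goodD.
have gE : good H E (fun w => - energy K w).
  by apply: goodN => //; apply: (@nice_good _ _ Y _ _ sl _ K) => //; exact: nice_energy.
have eq_j j : e (q j) <= 8 * 2^-1 ^+ j.
  rewrite (eZ sl)// ler_wpM2l//; apply: le_trans (e_sum sl K (gfrom j)) _.
  apply: le_trans (hm j K); apply: ler_sum => k _; rewrite /from.
  by case: (m j <= k)%N => //; rewrite (e_cst sl).
have geo : \sum_(j < K) 8 * 2^-1 ^+ j <= 16 :> R.
  have -> : \sum_(j < K) 8 * 2^-1 ^+ j = 16 - 16 * 2^-1 ^+ K :> R.
    elim: (K) => [|n IH]; first by rewrite big_ord0 expr0; lra.
    by rewrite big_ord_recr /= IH exprS; lra.
  by rewrite gerBl mulr_ge0// exprn_ge0.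
have eQ : e Q <= 16 + B.
  apply: le_trans (eD sl gsumq gsumb) _; apply: lerD.
    apply: le_trans (e_sum sl K gq) _; apply: le_trans geo.
    by apply: ler_sum => j _; exact: eq_j.
  by apply: le_trans (e_sum sl K gb) _; exact: hB.
have gT : good H E (fun w => \sum_(k < K) h k w * incr w k).
  apply: (@nice_good _ _ Y _ _ sl _ K) => //.
  apply: (nice_sum (U := fun k w => h k w * incr w k)) => k kK.
  by apply: niceM; [exact: nice_widen (ltnW kK) (nh k) | exact: nice_incr].
have e0 : 0 <= e (fun w => \sum_(k < K) h k w * incr w k).
  exact: (e_martingale_transform c_ge0 Yc sl HY indY K nh D1 D2).
have : e (fun w => \sum_(k < K) h k w * incr w k) <= e (fun w => - energy K w + Q w).
  apply: (e_mono sl) => //; first exact: goodD.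
  move=> w; rewrite /energy /Q.
  suff : \sum_(j < K) sqdev (from (m j) (incr w)) K <=
      \sum_(j < K) q j w - \sum_(k < K) h k w * incr w k by rewrite /b; lra.
  have -> : \sum_(k < K) h k w * incr w k =
      - \sum_(j < K) \sum_(k < K) from (m j) (doob_weight (from (m j) (incr w))) k * incr w k.
    rewrite exchange_big -sumrN /=; apply: eq_bigr => k _.
    by rewrite /h mulNr mulr_suml.
  rewrite opprK -big_split /=; apply: ler_sum => j _.
  apply: le_trans (sqdev_le _ _) _; rewrite /q.
  have -> : \sum_(i < K) from (m j) (incr w) i ^+ 2 =
      \sum_(k < K) from (m j) (fun k => incr w k ^+ 2) k.
    by apply: eq_bigr => i _; rewrite /from; case: ifP => //; rewrite expr0n.
  (* Moving the cut at [m j] from the increment to the weight leaves each product unchanged. *)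
  rewrite lerD2l; apply: ler_sum => i _; rewrite {2}/from {2}/from.
  by case: ifP; rewrite ?mulr0 ?mul0r.
have := eD sl gE gQ; lra.
Qed.

End Energy.

(** * Weak limits of the family *)

Section WeakCompactness.
Context {R : realType} {Omega : pointedType} (H : set (Omega -> R)).
Local Notation OH := (OmegaH H).

Lemma measurable_H (X : Omega -> R) : H X -> measurable_fun [set: OH] (X : OH -> R).
Proof.
by move=> HX _ B mB; rewrite setTI; apply: sub_sigma_algebra; exists X; split=> //; exists B.
Qed.

Lemma integrable_bounded_H (P : probability OH R) (X : Omega -> R) :
  H X -> Defs.bounded_fun X -> P.-integrable [set: OH] (EFin \o (X : OH -> R)).
Proof.
move=> HX [M hM]; apply: measurable_bounded_integrable => //.
- by apply: le_lt_trans (probability_le1 P measurableT) _; rewrite ltry.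
- exact: measurable_H.
- exists M; split; first exact: num_real.
  by move=> M' MM' w _ /=; apply: le_trans (hM w) (ltW MM').
Qed.

Context (E : (Omega -> R) -> \bar R) (Pfam : set (probability OH R)).
Context (sl : sublinear_space H E) (cc : condCC H E Pfam).
Context (Y : nat -> Omega -> R) (c : nat -> R).
Context (c_ge0 : forall n, 0 <= c n) (Yc : forall n w, `|Y n w| <= c n).
Context (HY : forall n, H (Y n)).

(** Weak convergence handles one [G K] at a time: for [K <= nk k], monotonicity bounds the integral
    of [G K] under [Pn (nk k)] by that of [G (nk k)], at most [C + 1]. The conclusion ranges over
    measurable supersets [A], so only the final event has to be shown measurable. *)
Lemma probability_energy_bounded (G : nat -> Omega -> R) (C : R) :
  (forall K, bounded_lipschitz_in Y K (G K)) ->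
  (forall K w, 0 <= G K w) ->
  (forall w, {homo G ^~ w : k n / (k <= n)%N >-> k <= n}) ->
  (forall K, - C <= e E (fun w => - G K w)) ->
  exists2 P, Pfam P & forall A : set OH, measurable A ->
    (forall w, (exists B, forall K, G K w <= B) -> A w) -> P A = 1%E.
Proof.
move=> nG G0 Gh GC.
have nNG K : bounded_lipschitz_in Y K (fun w => - G K w) by exact: niceN.
have HNG K : H (fun w => - G K w) by exact: (nice_H sl HY (nNG K)).
have HG K : H (G K) by exact: (nice_H sl HY (nG K)).
have bNG K := nice_bounded (nNG K).
have mG K : measurable_fun [set: OH] (G K : OH -> R) by exact: measurable_H.
have /choice[Pn hPn] : forall K, exists Q : probability OH R, Pfam Q /\
    ((- (C + 1))%:E <= \int[Q]_w (- G K w)%:E)%E.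
  move=> K.
  (* The supremum over the family may not be attained; the extra 1 leaves strict room to pick a
     member. *)
  have : ((- (C + 1))%:E < E (fun w => - G K w)%R)%E.
    rewrite (eK sl); last exact: good_bounded.
    by rewrite lte_fin; have := GC K; lra.
  rewrite (cc.1 _ (HNG K) (bNG K)) => /ereal_sup_gt[_ [Q PQ <-] hQ].
  by exists Q; split=> //; exact: ltW.
have [nk [P [nk_incr [PP cvgP]]]] := cc.2 Y Pn
  (fun k => conj (HY k) (ex_intro _ (c k) (Yc k))) (fun n => (hPn n).1).
exists P => // A mA hA.
have nk_ge k : (k <= nk k)%N.
  by elim: k => // k IH; apply: leq_ltn_trans IH (nk_incr k).
have lim_le K : (\int[P]_w (G K w)%:E <= (C + 1)%:E)%E.
  (* Condition (CC) concerns [d > 0], so [G K] is viewed as a function of [K.+1] coordinates to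
     cover [K = 0]. *)
  have [f hf Gf] := nice_widen (leqnSn K) (nNG K).
  have := cvgP K.+1 f (ltn0Sn K) hf.
  have -> : (fun k => \int[Pn (nk k)]_w (f (fun i : 'I_K.+1 => Y i w))%:E)%E =
      (fun k => \int[Pn (nk k)]_w (- G K w)%:E)%E.
    by apply/funext => k; apply: eq_integral => w _; rewrite Gf.
  have -> : (\int[P]_w (f (fun i : 'I_K.+1 => Y i w))%:E = \int[P]_w (- G K w)%:E)%E.
    by apply: eq_integral => w _; rewrite Gf.
  have -> : (\int[P]_w (- G K w)%:E = - \int[P]_w (G K w)%:E)%E.
    by rewrite -integral_ge0N// => w _; rewrite lee_fin.
  move=> hcv; have := @cvge_ge _ \oo _ _ _ _ (- (C + 1))%:E _ hcv.
  rewrite EFinN leeN2; apply.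
  near=> k; apply: le_trans (hPn (nk k)).2 _.
  apply: le_integral => //; [exact: integrable_bounded_H..|].
  move=> w _; rewrite lee_fin lerN2; apply: Gh; apply: leq_trans (nk_ge k).
  by near: k; exists K.
(* By monotone convergence the limit of [G K] is [P]-integrable, hence finite almost surely, and a
   finite limit bounds every [G K]. *)
pose g K (w : OH) := (G K w)%:E.
have mg K : measurable_fun [set: OH] (g K : OH -> \bar R) by exact/measurable_EFinP.
have g0 K w : [set: OH] w -> (0 <= g K w)%E by move=> _; rewrite lee_fin.
have gh w : [set: OH] w -> {homo g ^~ w : k n / (k <= n)%N >-> (k <= n)%E}.
  by move=> _ k n kn; rewrite lee_fin; exact: Gh.
have gcv w : cvgn (g ^~ w).
  by apply: ereal_nondecreasing_is_cvgn => k n; exact: gh.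
have intg : P.-integrable [set: OH] (fun w => limn (g ^~ w)).
  apply/integrableP; split.
    by apply: (emeasurable_fun_cvg g) => // w _; exact: gcv.
  under eq_integral => w _.
    rewrite gee0_abs; last by apply: lime_ge => //; apply: nearW => K; exact: g0.
    over.
  rewrite (monotone_convergence P measurableT mg g0 gh).
  apply: le_lt_trans (ltry (C + 1)); apply: lime_le.
    apply: ereal_nondecreasing_is_cvgn => k n kn; apply: ge0_le_integral => //.
    - by move=> w _; exact: g0.
    - by move=> w _; exact: gh.
  by apply: nearW => K; exact: lim_le.
have /negligibleP h0 : P.-negligible (~` A).
  have := integrable_ae measurableT intg.
  apply: negligibleS => w /= nAw; apply: contra_not nAw => /(_ I) hfin.
  apply: hA; exists (fine (limn (g ^~ w))) => K.
  rewrite -lee_fin fineK//; apply: (lime_ge (gcv w)).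
  by exists K => // n /= Kn; exact: gh.
have {}h0 := h0 (measurableC mA).
have := probability_setC P mA; rewrite h0 -(fineK (fin_num_measure P _ mA)) -EFinB.
by move=> [h1]; congr EFin; lra.
Unshelve. all: by end_near. Qed.

End WeakCompactness.

(** * The law of large numbers with prescribed means *)

Section Truncation.
Context {R : realType} {Omega : Type} (H : set (Omega -> R)) (E : (Omega -> R) -> \bar R).
Context (sl : sublinear_space H E) (X : nat -> Omega -> R).
Context (HX : forall n, H (X n)) (indX : indep_seq E X).
Context (gX2 : forall n, good H E (fun w => X n w ^+ 2)).
Local Notation e := (e E).
Local Notation good := (good H E).

Let gX n : good (X n).
Proof. exact: good_sqr (gX2 n). Qed.

Lemma H_clamp (c : R) n : 0 <= c -> H (fun w => clamp c (X n w)).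
Proof. by move=> c0; apply: (H_lip sl (HX n)) => s t; exact: clamp_lip. Qed.

Lemma good_clamp (c : R) n : 0 <= c -> good (fun w => clamp c (X n w)).
Proof.
move=> c0; apply: (good_bounded sl); first exact: H_clamp.
by exists c => w; exact: norm_clamp_le.
Qed.

Lemma indep_seq_clamp (c : nat -> R) : (forall n, 0 <= c n) ->
  indep_seq E (fun n w => clamp (c n) (X n w)).
Proof.
move=> c0 n n0 phi [[C hC] [M hM]].
pose psi (x : 'I_n -> R) y := phi (fun i => clamp (c i) (x i)) (clamp (c n) y).
apply: (indX n0 (phi := psi)); split; last by exists M => x y; exact: hM.
exists `|C| => x x' y y'; apply: le_trans (hC _ _ _ _) _.
apply: le_trans (ler_wpM2r _ (ler_norm C)) _; first by rewrite addr_ge0 ?nrm1_ge0.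
rewrite ler_wpM2l//; apply: lerD; last exact: clamp_lip.
by apply: ler_sum => i _; exact: clamp_lip.
Qed.

Lemma e_clamp_dist (c r : R) n : 0 < c ->
  `|e (fun w => r * X n w) - e (fun w => r * clamp c (X n w))| <=
  c^-1 * (`|r| * e (fun w => X n w ^+ 2)).
Proof.
move=> c0; have gr : good (fun w => `|r| * X n w ^+ 2) by exact: goodZ.
rewrite -(eZ sl)// -(eZ sl) ?invr_ge0 ?(ltW c0)//.
apply: (e_lip sl); [exact: goodZ | exact/(goodZ sl)/good_clamp/ltW | exact: goodZ |].
by move=> w; rewrite -mulrBr normrM mulrCA ler_wpM2l//; exact: clamp_dist.
Qed.

(** Both sides change by at most [V / c] when the [X k] are clamped at [c], and for clamped
    variables [e_sum_indep] applies; then [c] is taken arbitrarily large. *)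
Lemma e_sum_indep_good (r : R) n :
  e (fun w => \sum_(k < n) r * X k w) = \sum_(k < n) e (fun w => r * X k w).
Proof.
pose V := \sum_(k < n) `|r| * e (fun w => X k w ^+ 2).
have gr k : good (fun w => r * X k w) by exact: goodZ.
have gr2 k : good (fun w => `|r| * X k w ^+ 2) by exact: goodZ.
suff key c : 0 < c -> `|e (fun w => \sum_(k < n) r * X k w) -
    \sum_(k < n) e (fun w => r * X k w)| <= 2 * V / c.
  apply/eqP; rewrite -subr_eq0 -normr_eq0 eq_le normr_ge0 andbT.
  apply/ler_addgt0Pl => d d0; rewrite addr0.
  have V0 : 0 <= V.
    by apply: sumr_ge0 => k _; rewrite mulr_ge0// (e_ge0 sl)// => w; exact: sqr_ge0.
  (* At this level the error [2 V / c] is at most [d]; the added 1 keeps it positive when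
     [V = 0]. *)
  have c0 : 0 < (2 * V + 1) / d by rewrite divr_gt0//; lra.
  apply: le_trans (key _ c0) _; rewrite invf_div mulrA ler_pdivrMr; last lra.
  nra.
move=> c0; pose Yc k w := clamp c (X k w).
have gY k : good (fun w => r * Yc k w) by exact/(goodZ sl)/good_clamp/ltW.
have YE : e (fun w => \sum_(k < n) r * Yc k w) = \sum_(k < n) e (fun w => r * Yc k w).
  apply: (@e_sum_indep _ _ Yc (fun=> c) _ _ H) => //.
  - by move=> k; exact: ltW.
  - by move=> k w; apply: norm_clamp_le; exact: ltW.
  - by move=> k; apply: H_clamp; exact: ltW.
  - by apply: (@indep_seq_clamp (fun=> c)) => k; exact: ltW.
have h1 : `|e (fun w => \sum_(k < n) r * X k w) - e (fun w => \sum_(k < n) r * Yc k w)|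
    <= c^-1 * V.
  have gS : good (fun w => \sum_(k < n) `|r| * X k w ^+ 2) by exact: (good_sum sl n gr2).
  apply: (@le_trans _ _ (e (fun w => c^-1 * \sum_(k < n) `|r| * X k w ^+ 2))).
    apply: (e_lip sl); [exact: (good_sum sl n gr) | exact: (good_sum sl n gY) | exact: goodZ |].
    move=> w; rewrite -sumrB mulr_sumr; apply: le_trans (ler_norm_sum _ _ _) _.
    apply: ler_sum => k _; rewrite -mulrBr normrM mulrCA ler_wpM2l//; exact: clamp_dist.
  rewrite (eZ sl) ?invr_ge0 ?(ltW c0)// ler_wpM2l ?invr_ge0 ?(ltW c0)//.
  apply: le_trans (e_sum sl n gr2) _.
  by apply: ler_sum => k _; rewrite (eZ sl).
have h2 : `|\sum_(k < n) e (fun w => r * X k w) - \sum_(k < n) e (fun w => r * Yc k w)|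
    <= c^-1 * V.
  rewrite -sumrB mulr_sumr; apply: le_trans (ler_norm_sum _ _ _) _.
  by apply: ler_sum => k _; exact: e_clamp_dist.
rewrite YE in h1; have -> : 2 * V / c = c^-1 * V + c^-1 * V by ring.
set u := e _ in h1 *; set v := \sum_(k < n) _ in h2 *; set z := \sum_(k < n) _ in h1 h2.
have -> : u - v = (u - z) - (v - z) by ring.
by apply: le_trans (ler_normB _ _) _; exact: lerD.
Qed.

End Truncation.

Section PrescribedMeans.
Context {R : realType} {Omega : pointedType} (H : set (Omega -> R)).
Context (E : (Omega -> R) -> \bar R) (Pfam : set (probability (OmegaH H) R)).
Context (sl : sublinear_space H E) (cc : condCC H E Pfam) (X : nat -> Omega -> R).
Context (HX : forall n, H (X n)) (indX : indep_seq E X).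
Context (gX2 : forall n, good H E (fun w => X n w ^+ 2)).
Context (a : nat -> R) (a1 : forall n, 1 <= a n).
Context (ah : {homo a : n m / (n <= m)%N >-> n <= m}).
Local Notation e := (e E).

Lemma slln_prescribed_means (L : R) (mu : nat -> R) :
  (forall n, \sum_(k < n) e (fun w => X k w ^+ 2) / a k ^+ 2 <= L) ->
  (forall k, - e (fun w => - X k w) <= mu k <= e (X k)) ->
  exists2 P, Pfam P & forall A : set (OmegaH H), measurable A ->
    (forall w, negligible_wrt a (fun n => \sum_(i < n.+1) (X i w - mu i)) -> A w) ->
    P A = 1%E.
Proof.
move=> hL hmu; pose x2 k := e (fun w => X k w ^+ 2).
have x20 k : 0 <= x2 k by apply: (e_ge0 sl) => // w; exact: sqr_ge0.
(* This level makes [x2 k / c k <= 2^-k], so truncation shifts the means summably; the added 1 gives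
   [c k >= 1], so that [x2 k / c k ^ 2] is summable too. *)
pose c k : R := 2 ^+ k * (1 + x2 k).
have pow1 k : 1 <= 2 ^+ k :> R by apply: exprn_ege1; lra.
have c1 k : 1 <= c k by rewrite /c; have := pow1 k; have := x20 k; nra.
have c0 k : 0 < c k by have := c1 k; lra.
have c0' k : 0 <= c k by exact: ltW.
have x2c k : (c k)^-1 * x2 k <= 2^-1 ^+ k.
  rewrite mulrC ler_pdivrMr// /c mulrA -exprMn mulVf ?pnatr_eq0// expr1n; lra.
have geo n : \sum_(k < n) 2^-1 ^+ k <= 2 :> R.
  have -> : \sum_(k < n) 2^-1 ^+ k = 2 - 2 * 2^-1 ^+ n :> R.
    elim: n => [|n IH]; first by rewrite big_ord0 expr0; lra.
    by rewrite big_ord_recr /= IH exprS; lra.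
  by rewrite gerBl mulr_ge0// exprn_ge0.
pose Y k w := clamp (c k) (X k w).
have Yc k w : `|Y k w| <= c k by exact: norm_clamp_le.
have HY k : H (Y k) by exact: (H_clamp sl HX).
have indY : indep_seq E Y by exact: (indep_seq_clamp indX).
have gY k : good H E (Y k) by exact: (good_clamp sl HX).
have gYN k : good H E (fun w => - Y k w) by exact: goodN.
have gX k : good H E (X k) by exact: (good_sqr sl).
have gY2 k : good H E (fun w => Y k w ^+ 2).
  apply: (good_le sl (H_sqr sl (HY k)) _ (gX2 k)) => w.
  by rewrite ger0_norm ?sqr_ge0//; exact: clamp_sqr_le.
have eY2 k : e (fun w => Y k w ^+ 2) <= x2 k.
  by apply: (e_mono sl) => // w; exact: clamp_sqr_le.
have eXY k : `|e (X k) - e (Y k)| <= 2^-1 ^+ k.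
  apply: le_trans (x2c k); have := @e_clamp_dist _ _ _ _ sl _ HX gX2 (c k) 1 k (c0 k).
  have mul1 (f : Omega -> R) : (fun w => 1 * f w) = f by apply/funext => w; rewrite mul1r.
  by rewrite !mul1 normr1 mul1r.
have eXYN k : `|e (fun w => - X k w) - e (fun w => - Y k w)| <= 2^-1 ^+ k.
  apply: le_trans (x2c k); have := @e_clamp_dist _ _ _ _ sl _ HX gX2 (c k) (-1) k (c0 k).
  have mulN (f : Omega -> R) : (fun w => -1 * f w) = (fun w => - f w).
    by apply/funext => w; rewrite mulN1r.
  by rewrite !mulN normrN1 mul1r.
(* [nu k] projects [mu k] onto the interval of means of [Y k], whose endpoints are within [2^-k] of
   those of [X k]; hence [|nu k - mu k| <= 2^-k]. *)
pose nu k := Num.max (- e (fun w => - Y k w)) (Num.min (mu k) (e (Y k))).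
have YN k : - e (fun w => - Y k w) <= e (Y k) by have := eN_ge0 sl (gY k); lra.
have nuP k : [/\ - e (fun w => - Y k w) <= nu k, nu k <= e (Y k) &
    `|nu k - mu k| <= 2^-1 ^+ k].
  have := YN k; have /andP[] := hmu k; have := eXY k; have := eXYN k.
  have : 0 <= 2^-1 ^+ k :> R by apply: exprn_ge0.
  rewrite /nu !ler_norml; set p := - e _; set q := e (Y k).
  move=> ? /andP[? ?] /andP[? ?] ? ? ?.
  by case: (leP (mu k) q) => ?; [case: (leP p (mu k)) => ? | case: (leP p q) => ?];
    split=> //; try apply/andP; try split; lra.
pose r k := (a k)^-1; pose s k := - (nu k / a k).
have a0 k : 0 < a k by have := a1 k; lra.
have incrE k w : r k * Y k w + s k = (Y k w - nu k) / a k by rewrite /r /s; ring.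
have gr k : good H E (fun w => r k * Y k w) by exact: goodZ.
have D1 k : 0 <= e (fun w => r k * Y k w + s k).
  rewrite (eDc sl)// (eZ sl) ?invr_ge0 ?(ltW (a0 k))// /s mulrC -mulrBl.
  by rewrite divr_ge0 ?(ltW (a0 k))// subr_ge0; case: (nuP k).
have D2 k : 0 <= e (fun w => - (r k * Y k w + s k)).
  rewrite (_ : (fun w => _) = (fun w => r k * - Y k w + nu k / a k)); last first.
    by apply/funext => w; rewrite /r /s; ring.
  rewrite (eDc sl) ?(eZ sl) ?invr_ge0 ?(ltW (a0 k))//; last exact: goodZ.
  rewrite [_ * e _]mulrC -mulrDl divr_ge0 ?(ltW (a0 k))//.
  by have [] := nuP k; lra.
(* The factor 4 comes from [(Y - nu)^2 <= 2 Y^2 + 2 nu^2], where [nu^2] is also at most [e (Y^2)] by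
   [sqr_e_le]. *)
pose v k := 4 * (x2 k / a k ^+ 2).
have Dv k : e (fun w => (r k * Y k w + s k) ^+ 2) <= v k.
  have nu2 : nu k ^+ 2 <= e (fun w => Y k w ^+ 2).
    by apply: (sqr_e_le sl) => //; have [-> ->] := nuP k.
  have g2 : good H E (fun w => 2 * Y k w ^+ 2) by exact: goodZ.
  have g3 : good H E (fun w => 2 * Y k w ^+ 2 + 2 * nu k ^+ 2).
    by apply: (goodD sl) => //; exact: good_cst.
  apply: (@le_trans _ _ (e (fun w => r k ^+ 2 * (2 * Y k w ^+ 2 + 2 * nu k ^+ 2)))).
    apply: (e_mono sl); last first.
    - move=> w; rewrite incrE exprMn mulrC; apply: ler_wpM2l; first exact: sqr_ge0.
      by have := sqr_ge0 (Y k w + nu k); nra.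
    - exact: goodZ.
    - apply: (@nice_good _ _ Y _ _ sl _ k.+1) => //; apply: nice_X.
      apply: niceD; last exact: nice_cst.
      by apply: niceM; [exact: nice_cst | exact: (nice_coord c0' Yc)].
  rewrite (eZ sl) ?sqr_ge0// (eDc sl)// (eZ sl)// /v /r exprVn.
  rewrite mulrC mulrA ler_wpM2r ?invr_ge0 ?sqr_ge0//; have := eY2 k; lra.
have v0 k : 0 <= v k by rewrite mulr_ge0// divr_ge0// sqr_ge0.
have vL n : \sum_(k < n) v k <= 4 * L by rewrite -mulr_sumr ler_wpM2l.
have /choice[m hm] : forall j, exists m, forall n, \sum_(i < n) from m v i <= 2^-1 ^+ j.
  by move=> j; apply: (small_tail v0 vL); apply: exprn_gt0; lra.
have hB n : \sum_(k < n) e (fun w => (Y k w / c k) ^+ 2) <= 2.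
  apply: le_trans (geo n); apply: ler_sum => k _.
  have -> : (fun w => (Y k w / c k) ^+ 2) = (fun w => (c k ^+ 2)^-1 * Y k w ^+ 2).
    by apply/funext => w; rewrite exprMn exprVn mulrC.
  rewrite (eZ sl) ?invr_ge0 ?sqr_ge0//; apply: le_trans (x2c k).
  apply: ler_pM; rewrite ?invr_ge0 ?sqr_ge0 ?(e_ge0 sl)//.
    by move=> w; exact: sqr_ge0.
  by rewrite lef_pV2 ?posrE ?exprn_gt0// expr2 ler_peMl.
have hG := @energy_lower_bound _ _ _ _ c0' Yc m r s _ _ sl HY indY v 2 D1 D2 Dv hm hB.
have [P PP hP] := probability_energy_bounded sl cc Yc HY
  (nice_energy c0' Yc m r s) (energy_ge0 Y c m r s) (energy_homo Y c m r s) hG.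
exists P => // A mA hA; apply: hP => // w [B hw]; apply: hA.
have h1 K : \sum_(j < K) sqdev (from (m j) (fun k => (Y k w - nu k) / a k)) K <= B.
  apply: le_trans (hw K); rewrite /energy.
  have -> : (fun k => (Y k w - nu k) / a k) = (fun k => r k * Y k w + s k).
    by apply/funext => k; rewrite incrE.
  by rewrite lerDl sumr_ge0// => k _; exact: sqr_ge0.
have h2 K : \sum_(k < K) (Y k w / c k) ^+ 2 <= B.
  by apply: le_trans (hw K); rewrite lerDr sumr_ge0// => k _; exact: sqdev_ge0.
have [C hC] := clamp_sum_bounded (X := fun k => X k w) c0 h2.
(* [X - mu] is split into [(Y - nu) + (X - Y) + (nu - mu)]: bounded energy controls the first sum,
   and the other two have bounded partial sums. *)
have n1 := sqdev_bounded_negligible a1 ah h1.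
have n2 : negligible_wrt a (fun n => \sum_(i < n.+1) (X i w - Y i w)).
  by apply: (bounded_negligible_wrt (B := C)) => // n; exact: hC.
have n3 : negligible_wrt a (fun n => \sum_(i < n.+1) (nu i - mu i)).
  apply: (bounded_negligible_wrt (B := 2)) => // n.
  apply: le_trans (ler_norm_sum _ _ _) _; apply: le_trans (geo n.+1).
  by apply: ler_sum => k _; case: (nuP k).
have := negligible_wrtD (negligible_wrtD n1 n2) n3.
congr negligible_wrt; apply/funext => n; rewrite -!big_split /=.
by apply: eq_bigr => i _; ring.
Qed.

End PrescribedMeans.

(** * Upper and lower limits *)

Section Alternation.
Context {R : realType} (a p q : nat -> R) (aoo : a @ \oo --> +oo) (qp : forall k, q k <= p k).

Lemma sum_le_vanishing (z d : nat -> R) t n : (t <= n)%N ->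
  (forall i, z i <= d i) -> (forall i, (t < i <= n)%N -> z i = 0) ->
  \sum_(i < n.+1) z i <= \sum_(i < t.+1) d i.
Proof.
move=> tn zd z0; rewrite -(big_mkord xpredT z) (big_cat_nat (n := t.+1))//=.
rewrite [X in _ + X]big_nat_cond [X in _ + X]big1 ?addr0; last first.
  by move=> i /andP[/andP[ti iN] _]; rewrite z0// ti.
by rewrite big_mkord; apply: ler_sum.
Qed.

(* On blocks delimited by [t], chosen so long that the contribution of all
   previous blocks is negligible with respect to [a], [mu] is alternately [p] and [q]. *)
Lemma alternating_means : exists mu : nat -> R, [/\ forall k, q k <= mu k <= p k,
  forall e N, 0 < e -> exists2 n, (N <= n)%N & \sum_(i < n.+1) (p i - mu i) <= e * a n &
  forall e N, 0 < e -> exists2 n, (N <= n)%N & \sum_(i < n.+1) (mu i - q i) <= e * a n].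
Proof.
pose S t := \sum_(i < t.+1) (p i - q i).
(* [S t] is the largest discrepancy that the indices up to [t] can cause. The next block ends where
   [a] has reached [j.+1] times that amount. *)
have /choice[g hg] : forall jt : nat * nat, exists n,
    (jt.2 < n)%N /\ jt.1.+1%:R * S jt.2 <= a n.
  move=> [j t] /=; have /cvgryPge/(_ (j.+1%:R * S t)) [n _ hn] := aoo.
  exists (maxn n t.+1); split; first by rewrite leq_maxr.
  by apply: hn => /=; exact: leq_maxl.
pose t := fix t j := if j is k.+1 then g (k, t k) else 0%N.
have tS j : (t j < t j.+1)%N by case: (hg (j, t j)).
have th : {homo t : i j / (i <= j)%N}.
  by apply: homo_leq => [//|x y z /leq_trans|j]; [exact | exact: ltnW].
have tj j : (j <= t j)%N by elim: j => // j IH; exact: leq_ltn_trans IH (tS j).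
have ta j : j.+1%:R * S (t j) <= a (t j.+1) by case: (hg (j, t j)).
pose up i := `[< exists j, (t j.*2 < i <= t j.*2.+1)%N >].
pose mu i := if up i then p i else q i.
have mu1 i : q i <= mu i <= p i by rewrite /mu; case: (up i); rewrite lexx ?qp.
(* At [n = t j.+1] the last block contributes nothing, so the sum is at most
   [S (t j) <= a n / j.+1 <= e * a n]. *)
have conclude (z : nat -> R) (e : R) (N j : nat) : 0 < e -> (N <= j)%N -> e^-1 <= j.+1%:R ->
    (forall i, z i <= p i - q i) -> (forall i, (t j < i <= t j.+1)%N -> z i = 0) ->
    exists2 n, (N <= n)%N & \sum_(i < n.+1) z i <= e * a n.
  move=> e0 Nj ej zd z0; exists (t j.+1).
    by apply: leq_trans Nj _; apply: leq_trans (tj j) (ltnW (tS j)).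
  apply: le_trans (sum_le_vanishing (ltnW (tS j)) zd z0) _.
  rewrite -ler_pdivrMl//; apply: le_trans (ta j); apply: ler_wpM2r => //.
  by apply: sumr_ge0 => i _; rewrite subr_ge0.
have large (e : R) (N : nat) : exists2 j : nat, (N <= j)%N & e^-1 <= j%:R.
  exists (maxn N (Num.truncn e^-1).+1); first exact: leq_maxl.
  by apply: le_trans (ltW (truncnS_gt _)) _; rewrite ler_nat leq_maxr.
have dbl j : (j <= j.*2)%N by rewrite -addnn leq_addr.
exists mu; split => // e N e0; have [j Nj ej] := large e N.
- apply: (conclude (fun i => p i - mu i) e N j.*2) => //.
  + exact: leq_trans Nj (dbl j).
  + by apply: le_trans ej _; rewrite ler_nat; exact: leqW.
  + by move=> i; have /andP[] := mu1 i; lra.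
  + move=> i ti; rewrite /mu (_ : up i) ?subrr//.
    by apply/asboolP; exists j.
- apply: (conclude (fun i => mu i - q i) e N j.*2.+1) => //.
  + by apply: leq_trans Nj _; apply: leqW.
  + by apply: le_trans ej _; rewrite ler_nat; do 2 apply: leqW.
  + by move=> i; have /andP[] := mu1 i; lra.
  + move=> i /andP[ti iT]; rewrite /mu (_ : up i = false) ?subrr//.
    apply/asboolP => -[k /andP[tk kt]].
    have [kj|jk] := leqP k j.
      have := leq_trans ti kt; rewrite ltnNge th// ltnS leq_double//.
    have := leq_trans tk iT; rewrite ltnNge th//.
    by rewrite -doubleS leq_double.
Qed.

End Alternation.

Section ExtendedLimits.
Context {R : realType}.

(** Above, [b >= 0] leaves only the limit of [f]; below, the indices where [b] is small occur
    arbitrarily far out. The block ends of [alternating_means] supply such indices. *)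
Lemma limn_esup_sub0 (f b : nat -> R) : f @ \oo --> 0 -> (forall n, 0 <= b n) ->
  (forall e N, 0 < e -> exists2 n, (N <= n)%N & b n <= e) ->
  limn_esup (fun n => (f n - b n)%:E) = 0%E.
Proof.
move=> f0 b0 hb; rewrite limn_esup_lim.
have hf e : 0 < e -> exists N, forall n, (N <= n)%N -> `|f n| <= e.
  move=> e0; have /cvgrPdist_le/(_ e e0)[N _ hN] := f0.
  by exists N => n /hN; rewrite sub0r normrN.
apply/eqP; rewrite eq_le; apply/andP; split.
  apply/lee_addgt0Pr => e e0; rewrite add0e; have [N hN] := hf e e0.
  apply: lime_le; first exact: is_cvg_esups.
  exists N => // m /= Nm; apply: ge_ereal_sup => _ [n /= mn <-].
  rewrite lee_fin; have := b0 n; have := hN n (leq_trans Nm mn).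
  by rewrite ler_norml => /andP[]; lra.
apply/lee_subgt0Pr => e e0; rewrite sub0e.
have e2 : 0 < e / 2 by lra.
have [N hN] := hf _ e2.
apply: lime_ge; first exact: is_cvg_esups.
exists N => // m /= Nm; have [n mn bn] := hb _ m e2.
apply: (@le_trans _ _ (f n - b n)%:E).
  rewrite lee_fin; have := hN n (leq_trans Nm mn).
  by rewrite ler_norml => /andP[]; lra.
by apply: ereal_sup_ubound; exists n.
Qed.

(** This rewrites convergence to 0 as a condition on an upper limit, through which the event is
    shown to be measurable. *)
Lemma limn_esup_norm0 (f : nat -> R) :
  (limn_esup (fun n => `|f n|%:E) = 0%E) <-> (f @ \oo --> 0).
Proof.
split=> [h|h].
  have : (fun n => `|f n|%:E) @ \oo --> 0%E.
    by apply: limn_esup_le_cvg => [|n]; [rewrite h | rewrite lee_fin].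
  by move=> /fine_cvgP[_ hf]; apply/norm_cvg0P; exact: hf.
rewrite (_ : (fun n => _) = (fun n => (`|f n| - 0)%:E)); last first.
  by apply/funext => n; rewrite subr0.
apply: (limn_esup_sub0 (b := fun=> 0)) => //; last by move=> e N /ltW e0; exists N.
exact/norm_cvg0P.
Qed.

End ExtendedLimits.

(** * Measurability of the limit events *)

Section TailEvents.
Context {R : realType} {Omega : pointedType} (H : set (Omega -> R)) (f : nat -> Omega -> R).
Context (Hf : forall n, H (f n)).
Local Notation OH := (OmegaH H).

Let mf n : measurable_fun [set: OH] ((fun w => (f n w)%:E) : OH -> \bar R).
Proof. by apply/measurable_EFinP; exact: measurable_H. Qed.

Lemma measurable_limn_esup_eq0 :
  measurable [set w : OH | limn_esup (fun n => (f n w)%:E) = 0%E].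
Proof.
rewrite -[X in measurable X]setTI.
exact: (measurable_fun_limn_esup (f := fun n (w : OH) => (f n w)%:E) mf measurableT
  (emeasurable_set1 0%E)).
Qed.

End TailEvents.

Lemma measurable_limn_einf_eq0 {R : realType} {Omega : pointedType} (H : set (Omega -> R))
    (f : nat -> Omega -> R) : (forall n, H (fun w => - f n w)) ->
  measurable [set w : OmegaH H | limn_einf (fun n => (f n w)%:E) = 0%E].
Proof.
move=> /measurable_limn_esup_eq0; congr measurable; apply/seteqP; split=> w /=.
  by rewrite /limn_einf => h; rewrite -[RHS]oppe0 -h.
by rewrite /limn_einf => /(congr1 oppe); rewrite oppeK oppe0.
Qed.

Lemma measurable_cvg0 {R : realType} {Omega : pointedType} (H : set (Omega -> R))
    (f : nat -> Omega -> R) : (forall n, H (fun w => `|f n w|)) ->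
  measurable [set w : OmegaH H | (fun n => f n w) @ \oo --> 0].
Proof.
move=> /measurable_limn_esup_eq0; congr measurable; apply/seteqP; split=> w /=.
  by move=> /(limn_esup_norm0 (fun n => f n w)).
by move=> h; apply/(limn_esup_norm0 (fun n => f n w)).
Qed.

(** * Deduction of both assertions from the law with prescribed means *)

Theorem theorem3p2 (R : realType) (Omega : pointedType) (H : set (Omega -> R))
    (E : (Omega -> R) -> \bar R) (Pfam : set (probability (OmegaH H) R))
    (X : nat -> Omega -> R) (a : nat -> R) :
  sublinear_space H E -> condCC H E Pfam ->
  (forall n, H (X n)) -> indep_seq E X ->
  (forall n, 1 <= a n) -> {homo a : n m / (n <= m)%N >-> n <= m} ->
  a @ \oo --> +oo ->
  (\sum_(0 <= n <oo) (E (fun w => (X n w ^+ 2)%R) * ((a n ^+ 2)^-1)%:E) < +oo)%E ->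
  let Ssum := fun (n : nat) (w : Omega) => \sum_(i < n.+1) X i w in
  (exists P : probability (OmegaH H) R, Pfam P /\
     let A := [set w : OmegaH H |
         limn_esup (fun n => ((Ssum n w - fine (E (Ssum n))) / a n)%:E) = 0%E /\
         limn_einf (fun n => ((Ssum n w - fine (Ehat E (Ssum n))) / a n)%:E) = 0%E] in
     measurable A /\ P A = 1%E) /\
  (forall mu : nat -> R,
     (forall n, (Ehat E (X n) <= (mu n)%:E)%E /\ ((mu n)%:E <= E (X n))%E) ->
     exists P : probability (OmegaH H) R, Pfam P /\
       let A := [set w : OmegaH H |
           (fun n => (\sum_(i < n.+1) (X i w - mu i)) / a n) @ \oo --> 0] in
       measurable A /\ P A = 1%E).
Proof.
move=> sl cc HX indX a1 ah aoo hser Ssum.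
pose x2 k := E (fun w => X k w ^+ 2).
have x20 k : (0%E <= x2 k)%E.
  by apply: (E_ge0 sl) => [|w]; [exact: (H_sqr sl (HX k)) | exact: sqr_ge0].
have ia k : 0 < (a k ^+ 2)^-1 by rewrite invr_gt0 exprn_gt0// (lt_le_trans ltr01).
have term0 k : (0%E <= x2 k * ((a k ^+ 2)^-1)%:E)%E.
  by rewrite mule_ge0// lee_fin ltW.
have partial n : (\sum_(0 <= k < n) x2 k * ((a k ^+ 2)^-1)%:E <
    +oo)%E.
  by apply: le_lt_trans hser; exact: nneseries_lim_ge.
(* An infinite second moment would make a partial sum of the nonnegative series infinite. *)
have x2fin k : (x2 k < +oo)%E.
  rewrite ltNge leye_eq; apply/negP => /eqP h.
  have := partial k.+1; rewrite big_nat_recr//= h gt0_mulye ?lte_fin//.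
  rewrite addey// gt_eqF// (lt_le_trans ltNy0)// sume_ge0// => i _; exact: term0.
have gX2 k : good H E (fun w => X k w ^+ 2).
  split; first exact: (H_sqr sl (HX k)).
  by under eq_fun do rewrite ger0_norm ?sqr_ge0//; exact: x2fin.
have gX k : good H E (X k) by exact: (good_sqr sl (HX k) (gX2 k)).
have gXN k : good H E (fun w => - X k w) by exact: (goodN sl).
have [L hL] : exists L, forall n, \sum_(k < n) e E (fun w => X k w ^+ 2) / a k ^+ 2 <= L.
  set L := limn _ in hser; exists (fine L) => n.
  have L0 : (0%E <= L)%E by apply: nneseries_ge0 => k _ _; exact: term0.
  rewrite -lee_fin fineK ?ge0_fin_numE//.
  apply: le_trans (nneseries_lim_ge n (fun k _ _ => term0 k)).
  rewrite big_mkord -sumEFin; apply: lee_sum => k _.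
  by rewrite EFinM /x2 (eK sl (gX2 k)).
have HS (s : R) (n : nat) (t b : R) : H (fun w => (\sum_(i < n) s * X i w - t) / b).
  rewrite (_ : (fun w => _) = (fun w => b^-1 * (\sum_(i < n) s * X i w - t))).
    apply: (H_scale sl); apply: (H_add sl); last exact: (H_cst sl).
    apply: good_H; apply: (good_sum sl n (X := fun i w => s * X i w)) => i.
    exact: (goodZ sl).
  by apply/funext => w; rewrite mulrC.
have part2 mu : (forall k, - e E (fun w => - X k w) <= mu k <= e E (X k)) ->
    exists2 P, Pfam P & forall A : set (OmegaH H), measurable A ->
    (forall w, (fun n => (\sum_(i < n.+1) (X i w - mu i)) / a n) @ \oo --> 0 -> A w) ->
    P A = 1%E.
  move=> hmu; have [P PP hP] := slln_prescribed_means sl cc HX indX gX2 a1 ah hL hmu.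
  exists P => // A mA hA; apply: hP => // w hw; apply: hA.
  exact: negligible_wrt_cvg.
split; last first.
  move=> mu hmu; have /part2[P PP hP] : forall k, - e E (fun w => - X k w) <= mu k <= e E (X k).
    move=> k; have [] := hmu k; rewrite /Ehat (eK sl (gX k)) (eK sl (gXN k)).
    by rewrite -EFinN !lee_fin => -> ->.
  exists P; split=> // A.
  have mA : measurable A.
    apply: measurable_cvg0 => n; apply: (H_abs sl).
    have := HS 1 n.+1 (\sum_(i < n.+1) mu i) (a n); congr H; apply/funext => w.
    by rewrite sumrB; congr ((_ - _) / _); apply: eq_bigr => i _; rewrite mul1r.
  by split=> //; apply: hP.
(* The cases [s = 1] and [s = -1] show that the upper and lower expectations of [Ssum n] are the
   sums of those of the [X i]. *)
have ES (s : R) n : e E (fun w => \sum_(i < n) s * X i w) = \sum_(i < n) e E (fun w => s * X i w).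
  exact: (e_sum_indep_good sl HX indX gX2).
have ES1 n : fine (E (Ssum n)) = \sum_(i < n.+1) e E (X i).
  have := ES 1 n.+1; have mul1 (Z : Omega -> R) : (fun w => 1 * Z w) = Z.
    by apply/funext => w; rewrite mul1r.
  rewrite (_ : (fun w => _) = Ssum n); last first.
    by apply/funext => w; apply: eq_bigr => i _; rewrite mul1r.
  by rewrite /e => ->; apply: eq_bigr => i _; rewrite -/(e E _) mul1.
have ESN n : fine (Ehat E (Ssum n)) = \sum_(i < n.+1) - e E (fun w => - X i w).
  rewrite /Ehat fineN sumrN; congr (- _).
  have := ES (-1) n.+1; rewrite (_ : (fun w => _) = (fun w => - Ssum n w)); last first.
    by apply/funext => w; rewrite /Ssum -sumrN; apply: eq_bigr => i _; rewrite mulN1r.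
  rewrite {1}/e => ->; apply: eq_bigr => i _; congr (e E); apply/funext => w.
  by rewrite mulN1r.
have qp k : - e E (fun w => - X k w) <= e E (X k) by have := eN_ge0 sl (gX k); lra.
have [mu [hmu up dn]] := alternating_means aoo qp.
have [P PP hP] := part2 mu hmu.
exists P; split=> // A.
have a0 n : 0 < a n by exact: lt_le_trans (a1 n).
have mA : measurable A.
  apply: measurableI.
    apply: measurable_limn_esup_eq0 => n.
    have := HS 1 n.+1 (fine (E (Ssum n))) (a n); congr H; apply/funext => w.
    by congr ((_ - _) / _); apply: eq_bigr => i _; rewrite mul1r.
  apply: measurable_limn_einf_eq0 => n; apply: (H_opp sl).
  have := HS 1 n.+1 (fine (Ehat E (Ssum n))) (a n); congr H; apply/funext => w.
  by congr ((_ - _) / _); apply: eq_bigr => i _; rewrite mul1r.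
split=> //; apply: hP => // w hw.
have rescale (b : nat -> R) :
    (forall d N, 0 < d -> exists2 n, (N <= n)%N & b n <= d * a n) ->
    forall d N, 0 < d -> exists2 n, (N <= n)%N & b n / a n <= d.
  move=> hb d N d0; have [n Nn bn] := hb d N d0; exists n => //.
  by rewrite ler_pdivrMr.
split.
  (* [S_n - E[S_n]] is the sum of [X i - mu i], negligible by the choice of [P], minus the
     nonnegative sum of [E[X_i] - mu i], small infinitely often. *)
  have := limn_esup_sub0 hw _ (rescale _ up) => <-.
    congr limn_esup; apply/funext => n; rewrite ES1; congr EFin.
    rewrite -mulrBl -sumrB /Ssum -sumrB; congr (_ / _); apply: eq_bigr => i _; ring.
  move=> n; apply: divr_ge0; last exact: ltW.
  by apply: sumr_ge0 => i _; rewrite subr_ge0; case/andP: (hmu i).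
(* The lower limit is handled through opposites: the amount subtracted is now the sum of [mu i]
   minus the lower means, small at the ends of the other blocks. *)
have hwN : (fun n => - ((\sum_(i < n.+1) (X i w - mu i)) / a n)) @ \oo --> 0.
  by have h := cvgN hw; rewrite oppr0 in h; exact: h.
rewrite /limn_einf -[RHS]oppe0; congr oppe.
have := limn_esup_sub0 hwN _ (rescale _ dn) => <-.
  congr limn_esup; apply/funext => n /=; rewrite ESN; congr EFin.
  rewrite -opprD -mulrDl -big_split /= /Ssum -sumrB; congr (- (_ / _)).
  by apply: eq_bigr => i _; ring.
move=> n; apply: divr_ge0; last exact: ltW.
by apply: sumr_ge0 => i _; rewrite subr_ge0; case/andP: (hmu i).
Qed.
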